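(* Consider the transformed initial-boundary-value problem for $u:\Omega\to\mathbb C$, $\Omega=[0,R]\times[0,1]$, $$\Lambda(r)\Big(u_r-\mathrm i\,\tfrac{\lambda}{q}\,u-\tfrac{\dot s(r)}{s(r)}\,y\,u_y\Big)=\mathrm i\,\tfrac{\lambda s^2(r)}{\alpha^2q^2}\,u\ \text{ in }\Omega,\qquad u(r,0)=0,\quad u(r,1)=u_y(r,1)=0,\quad u(0,y)=u_0(y),$$ and let $u$ be its (sufficiently smooth) solution. Assume that $$\inf_{\Omega}\Big[\tfrac{1}{C_{DPF}^2}-\tfrac{s^2}{\alpha^2|q|^2}\big(\mathrm{Re}(q)+|q|^2\,\mathrm{Re}(\gamma)\big)\Big]>0,$$ or that there exists $\delta_\star\in\{1,-1\}$ such that $$\inf_{\Omega}\Big[\tfrac{\delta_\star s^2}{\alpha^2|q|^2}\big(\mathrm{Im}(q)-|q|^2\,\mathrm{Im}(\gamma)\big)\Big]>0 .$$ For $J\ge3$ and $N\in\mathbb N$, with $h=1/J$ and $k=R/N$, let $(U^m)_{m=0}^N\subset X_h$ be the Crank–Nicolson-type finite difference approximation: $U^0=P_hu_0$ and, for $n=1,\dots,N$, $$\tfrac{U^n-U^{n-1}}{k}-\delta(r^{n-\frac12})\,\omega\otimes\partial_h\big(\tfrac{U^n+U^{n-1}}{2}\big)=\mathrm i\,\xi(r^{n-\frac12})\,T_h(r^{n-\frac12})\big(\tfrac{U^n+U^{n-1}}{2}\big)+\mathrm i\,\tfrac{\lambda}{q}\big(\tfrac{U^n+U^{n-1}}{2}\big).$$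 Let $u^n\in X_h$ be given by $(u^n)_j=u(r^n,y_j)$, $1\le j\le J-1$, and define $\eta^n\in X_h$, $n=1,\dots,N$, by $$\tfrac{u^n-u^{n-1}}{k}-\delta(r^{n-\frac12})\,\omega\otimes\partial_h\big(\tfrac{u^n+u^{n-1}}{2}\big)=\mathrm i\,\xi(r^{n-\frac12})\,T_h(r^{n-\frac12})\big(\tfrac{u^n+u^{n-1}}{2}\big)+\mathrm i\,\tfrac{\lambda}{q}\big(\tfrac{u^n+u^{n-1}}{2}\big)+\eta^n .$$ Then there exist constants $C_1>0$, $C_2>0$ and $C_3\ge0$, independent of $k$ and $h$, such that if $C_3\,k\le3$, then $$\max_{0\le n\le N}\|U^n-u^n\|_{0,h}\le C_1\max_{1\le n\le N}\|\eta^n\|_{0,h}$$ and $$\max_{2\le n\le N}\Big|\omega\otimes\Big(\tfrac{u^n+u^{n-1}}{2}-\tfrac{U^n+U^{n-1}}{2}\Big)\Big|_{\infty,h}\le C_2\Big[k^{-1}\max_{2\le n\le N}\|\eta^n-\eta^{n-1}\|_{0,h}+\max_{1\le n\le N}\|\eta^n\|_{0,h}\Big].$$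
   Context: Data: $R>0$, $\alpha>0$; $p,q\in\mathbb C$, $q\ne0$; $\lambda=\frac{p-q}{\alpha}$; $s:[0,R]\to(0,\infty)$ smooth with $\dot s=ds/dr>0$ on $[0,R]$; $\mathcal D=\{(r,z):0\le z\le s(r),\,0\le r\le R\}$; $\beta:\mathcal D\to\mathbb C$ smooth; $\gamma(r,y)=\beta(r,y\,s(r))$ for $(r,y)\in\Omega$; $I=[0,1]$. For $r\in[0,R]$, $\Lambda(r):H^2(I)\cap H^1_0(I)\to L^2(I)$ is $\Lambda(r)v=-v''-\frac{(1+q\gamma(r,\cdot))s^2(r)}{\alpha^2q}v$; in particular the argument of $\Lambda(r)$ in the equation for $u$ vanishes at $y=0$ and $y=1$. Put $\delta(r)=\dot s(r)/s(r)$ and $\xi(r)=\frac{\lambda s^2(r)}{\alpha^2q^2}$. Discretization: for $J\in\mathbb N$, $J\ge3$: $h=1/J$, $y_j=jh$ $(0\le j\le J)$, $X_h=\{(v_j)_{j=0}^J\in\mathbb C^{J+1}:v_0=v_J=0\}$. Norms on $X_h$: $\|v\|_{0,h}=(h\sum_{j=1}^{J-1}|v_j|^2)^{1/2}$, $|v|_{1,h}=\big(h\sum_{j=0}^{J-1}|\frac{v_{j+1}-v_j}{h}|^2\big)^{1/2}$, $|v|_{\infty,h}=\max_{1\le j\le J-1}|v_j|$. For $v,w\in X_h$ and $1\le j\le J-1$ (entries $0$ and $J$ of an element of $X_h$ being zero): $(\Delta_hv)_j=\frac{v_{j-1}-2v_j+v_{j+1}}{h^2}$, $(\partial_hv)_j=\frac{v_{j+1}-v_{j-1}}{2h}$,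 $(v\otimes w)_j=v_jw_j$, $\omega_j=y_j$; for $f:[0,1]\to\mathbb C$, $(P_hf)_j=f(y_j)$. The operator $\Lambda_h(r):X_h\to X_h$ is $(\Lambda_h(r)v)_j=-(\Delta_hv)_j-s^2(r)\frac{1+q\gamma(r,y_j)}{\alpha^2q}v_j$, and $T_h(r)=\Lambda_h(r)^{-1}$ (it exists under the stated hypotheses). $C_{DPF}\in(0,\frac{\sqrt2}{2}]$ is the optimal constant in the discrete Poincaré–Friedrichs inequality $\|v\|_{0,h}\le C_{DPF}|v|_{1,h}$ for all $v\in X_h$ (valid for all $J\ge3$). Range nodes: for $N\in\mathbb N$, $k=R/N$, $r^n=nk$, $r^{n-\frac12}=\frac{r^n+r^{n-1}}{2}$. *)

(* Defs.v *)
From mathcomp Require Import all_boot all_order all_algebra.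
From mathcomp Require Import all_classical all_reals all_analysis.
From mathcomp Require Export complex.

Set Implicit Arguments.
Unset Strict Implicit.
Unset Printing Implicit Defensive.

Import Order.TTheory GRing.Theory Num.Theory.
Import numFieldNormedType.Exports.

Local Open Scope classical_set_scope.
Local Open Scope ring_scope.
Local Open Scope complex_scope.

(* The modulus of complex.v as a real number; `|z| itself lives in R[i]. *)
Definition modc (R : realType) (z : R[i]) : R := ComplexField.Normc.normc z.

(* Functions on a closed region are total functions whose values outside the
   region are irrelevant: derivatives are taken relative to the region, hence
   are one-sided at its boundary. *)
Section DerivativesOnClosedSets.
Variable R : realType.

Definition within_quotient (A : set R) (f : R -> R) (x : R) :=
  (fun t => (f t - f x) / (t - x)) @ within A x^'.

Definition within_derive (A : set R) (f : R -> R) (x : R) : R :=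
  lim (within_quotient A f x).

Definition within_deriveC (A : set R) (f : R -> R[i]) (x : R) : R[i] :=
  within_derive A (@complex.Re R \o f) x +i* within_derive A (@complex.Im R \o f) x.

Definition smooth1 (A : set R) (f : R -> R) : Prop :=
  forall (n : nat) (x : R), A x ->
    cvg (within_quotient A (iter n (within_derive A) f) x).

(* C^m up to the boundary of a planar region A that is the closure of its
   interior: the partial derivatives F i j of order i + j <= m exist in the
   interior and extend continuously to A. *)
Definition Cm_upto (m : nat) (A : set (R * R)) (f : R * R -> R) : Prop :=
  exists F : nat -> nat -> R * R -> R,
    [/\ forall x, A x -> F 0%N 0%N x = f x,
        forall i j, (i + j <= m)%N -> {within A, continuous (F i j)} &
        forall i j (x : R * R), (i + j < m)%N -> A° x ->
          is_derive x.1 1 (fun t => F i j (t, x.2)) (F i.+1 j x) /\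
          is_derive x.2 1 (fun t => F i j (x.1, t)) (F i j.+1 x)].

Definition CmC_upto (m : nat) (A : set (R * R)) (f : R * R -> R[i]) : Prop :=
  Cm_upto m A (@complex.Re R \o f) /\ Cm_upto m A (@complex.Im R \o f).

Definition smoothC_upto (A : set (R * R)) (f : R * R -> R[i]) : Prop :=
  forall m, CmC_upto m A f.

End DerivativesOnClosedSets.

Section Continuous.
Variables (R : realType) (rmax alpha : R) (p q : R[i]).
Variables (s : R -> R) (beta : R * R -> R[i]).

Definition Omega : set (R * R) :=
  [set x | 0 <= x.1 <= rmax /\ 0 <= x.2 <= 1].

Definition calD : set (R * R) :=
  [set x | 0 <= x.1 <= rmax /\ 0 <= x.2 <= s x.1].

Definition sdot (r : R) : R := within_derive `[0, rmax] s r.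

Definition lam : R[i] := (p - q) / alpha%:C.

Definition gam (r y : R) : R[i] := beta (r, y * s r).

Definition dlt (r : R) : R := sdot r / s r.

Definition xi (r : R) : R[i] :=
  lam * (s r)%:C ^+ 2 / (alpha%:C ^+ 2 * q ^+ 2).

Definition Lambda (r : R) (v : R -> R[i]) (y : R) : R[i] :=
  - within_deriveC `[0, 1] (within_deriveC `[0, 1] v) y
  - (1 + q * gam r y) * (s r)%:C ^+ 2 / (alpha%:C ^+ 2 * q) * v y.

Definition d_r (u : R * R -> R[i]) (r y : R) : R[i] :=
  within_deriveC `[0, rmax] (fun t => u (t, y)) r.

Definition d_y (u : R * R -> R[i]) (r y : R) : R[i] :=
  within_deriveC `[0, 1] (fun t => u (r, t)) y.

Definition Lambda_arg (u : R * R -> R[i]) (r y : R) : R[i] :=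
  d_r u r y - 'i * (lam / q) * u (r, y) - (sdot r / s r * y)%:C * d_y u r y.

(* The third order derivatives u_ryy and u_yyy are the highest ones that occur
   in the equation.  The second clause is membership of the argument of
   Lambda r in the domain of that operator. *)
Definition is_solution (u0 : R -> R[i]) (u : R * R -> R[i]) : Prop :=
  [/\ CmC_upto 3 Omega u,
      forall r, 0 <= r <= rmax -> Lambda_arg u r 0 = 0 /\ Lambda_arg u r 1 = 0,
      forall r y, Omega (r, y) ->
        Lambda r (Lambda_arg u r) y = 'i * xi r * u (r, y),
      forall r, 0 <= r <= rmax ->
        [/\ u (r, 0) = 0, u (r, 1) = 0 & d_y u r 1 = 0] &
      forall y, 0 <= y <= 1 -> u (0, y) = u0 y].

End Continuous.

(* An element of X_h is the row vector of its J - 1 interior entries: the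
   column index i : 'I_(J.-1) stands for the node y_(i.+1). *)
Section Discrete.
Variables (R : realType) (J : nat).

Definition hstep : R := J%:R^-1.
Definition node (j : nat) : R := j%:R * hstep.

(* v_j for 0 <= j <= J, with v_0 = v_J = 0 *)
Definition entry (v : 'rV[R[i]]_(J.-1)) (j : nat) : R[i] :=
  if j is j'.+1 then oapp (v 0) 0 (insub j') else 0.

Definition norm0h (v : 'rV[R[i]]_(J.-1)) : R :=
  Num.sqrt (hstep * \sum_(1 <= j < J) modc (entry v j) ^+ 2).

Definition norm1h (v : 'rV[R[i]]_(J.-1)) : R :=
  Num.sqrt (hstep *
    \sum_(0 <= j < J) modc ((entry v j.+1 - entry v j) / hstep%:C) ^+ 2).

Definition norminfh (v : 'rV[R[i]]_(J.-1)) : R :=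
  \big[Num.max/0]_(1 <= j < J) modc (entry v j).

Definition Deltah (v : 'rV[R[i]]_(J.-1)) : 'rV[R[i]]_(J.-1) :=
  \row_i ((entry v i - 2 * entry v i.+1 + entry v i.+2) / hstep%:C ^+ 2).

Definition partialh (v : 'rV[R[i]]_(J.-1)) : 'rV[R[i]]_(J.-1) :=
  \row_i ((entry v i.+2 - entry v i) / (2 * hstep%:C)).

Definition otimes (v w : 'rV[R[i]]_(J.-1)) : 'rV[R[i]]_(J.-1) :=
  map2_mx *%R v w.

Definition omega : 'rV[R[i]]_(J.-1) := \row_i (node i.+1)%:C.

Definition Ph (f : R -> R[i]) : 'rV[R[i]]_(J.-1) := \row_i f (node i.+1).

Definition avg (v w : 'rV[R[i]]_(J.-1)) : 'rV[R[i]]_(J.-1) :=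
  2^-1 *: (v + w).

Definition Lambdah (alpha : R) (q : R[i]) (s : R -> R) (beta : R * R -> R[i])
    (r : R) (v : 'rV[R[i]]_(J.-1)) : 'rV[R[i]]_(J.-1) :=
  - Deltah v
  - \row_i ((s r)%:C ^+ 2 *
       ((1 + q * gam s beta r (node i.+1)) / (alpha%:C ^+ 2 * q)) * v 0 i).

Definition Th (alpha : R) (q : R[i]) (s : R -> R) (beta : R * R -> R[i])
    (r : R) (v : 'rV[R[i]]_(J.-1)) : 'rV[R[i]]_(J.-1) :=
  v *m invmx (lin1_mx (Lambdah alpha q s beta r)).

End Discrete.

Arguments hstep {R} J.
Arguments node {R} J j.
Arguments omega {R} J.
Arguments Ph {R} J f.

(* Optimal constant for all J >= 3 at once, so it does not depend on h. *)
Definition CDPF (R : realType) : R :=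
  inf [set C : R | 0 <= C /\
         forall (J : nat) (v : 'rV[R[i]]_(J.-1)), (3 <= J)%N ->
           norm0h v <= C * norm1h v].

Section Scheme.
Variables (R : realType) (rmax alpha : R) (p q : R[i]).
Variables (s : R -> R) (beta : R * R -> R[i]) (J N : nat).

Definition kstep : R := rmax / N%:R.
Definition rnode (n : nat) : R := n%:R * kstep.
Definition rmid (n : nat) : R := (rnode n + rnode n.-1) / 2.

(* Left- and right-hand sides of the scheme at step n, applied to an arbitrary
   sequence in X_h; meaningful for 1 <= n <= N. *)
Definition scheme_lhs (V : nat -> 'rV[R[i]]_(J.-1)) (n : nat) :=
  (kstep%:C)^-1 *: (V n - V n.-1)
  - (dlt rmax s (rmid n))%:C *:
      otimes (omega J) (partialh (avg (V n) (V n.-1))).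

Definition scheme_rhs (V : nat -> 'rV[R[i]]_(J.-1)) (n : nat) :=
  ('i * xi alpha p q s (rmid n)) *:
      Th alpha q s beta (rmid n) (avg (V n) (V n.-1))
  + ('i * (lam alpha p q / q)) *: avg (V n) (V n.-1).

Definition is_scheme_solution (u0 : R -> R[i]) (U : nat -> 'rV[R[i]]_(J.-1)) :
    Prop :=
  U 0%N = Ph J u0 /\
  forall n, (1 <= n <= N)%N -> scheme_lhs U n = scheme_rhs U n.

Definition nodal (u : R * R -> R[i]) (n : nat) : 'rV[R[i]]_(J.-1) :=
  Ph J (fun y => u (rnode n, y)).

End Scheme.

(* Main.v *)
From HB Require Import structures.
Require Import Defs.
From mathcomp Require Import all_boot all_order all_algebra.
From mathcomp Require Import all_classical all_reals all_analysis.
From mathcomp Require Import ring lra.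

(* With e = u - U, the error equation reads (e^n - e^{n-1})/k = A_n ebar^n + eta^n, where
   A_r v = delta(r) W v + i xi(r) T_h(r) v + i (lambda/q) v, W v = omega (x) partial_h v and ebar^n
   is the mean of e^n and e^{n-1}.  Summation by parts gives Re (W v, v) <= |v|^2 / 2, and either
   hypothesis makes Lambda_h(r) coercive uniformly in r and h, so T_h(r) is bounded and, by the
   resolvent identity, Lipschitz in r.  Testing with ebar^n and a discrete Gronwall inequality
   bound e.  The quotients d^n = (e^n - e^{n-1})/k satisfy a scheme of the same type, whose extra
   term (A_n - A_{n-1}) ebar^{n-1} costs O(k) (|W ebar^{n-1}| + |ebar^{n-1}|); since delta is
   bounded below, the error equation bounds W ebar by d, e and eta, so Gronwall applies to d as
   well.  Finally |omega (x) v|_inf <= 2 |W v| + 2 |v|. *)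

Set Implicit Arguments.
Unset Strict Implicit.
Unset Printing Implicit Defensive.

Import Order.TTheory GRing.Theory Num.Theory.
Import numFieldNormedType.Exports.

Local Open Scope classical_set_scope.
Local Open Scope ring_scope.
Local Open Scope complex_scope.

Local Notation Re := complex.Re.
Local Notation Im := complex.Im.

Local Arguments entry : simpl never.

(** * The discrete space X_h *)

(** The mesh operator [W] has norm of order 1/h, so a bound on the error gives no bound on [W] of it
    that is uniform in h. The only access to [W] is the error equation itself, at the price of a
    difference quotient in r; this is why the quotients need their own estimate and why increments
    of eta enter the second bound. That estimate is circular: the variation of the step operators is
    measured by [W], hence by the quotients again. The loop closes because the feedback carries a
    factor k and only raises the Gronwall rate from [K / 2] to [K / 2 + L1 * M]. The restriction on
    k in the theorem says that k times this larger rate is at most 1/2. Inner products are taken as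
    real parts throughout, so that energy estimates stay in the real field; the two alternatives of
    the hypothesis then correspond to testing with v and with a real multiple of iv. *)

Section Modulus.
Variable R : realType.
Implicit Types (z w : R[i]) (a : R).

Lemma modc0 : modc (0 : R[i]) = 0.
Proof. exact: ComplexField.Normc.normc0. Qed.

Lemma modc1 : modc (1 : R[i]) = 1.
Proof. exact: ComplexField.Normc.normc1. Qed.

Lemma modcM z w : modc (z * w) = modc z * modc w.
Proof. exact: ComplexField.Normc.normcM. Qed.

Lemma modcV z : modc z^-1 = (modc z)^-1.
Proof. exact: ComplexField.Normc.normcV. Qed.

Lemma modcD z w : modc (z + w) <= modc z + modc w.
Proof. exact: le_normcD. Qed.

Lemma modcN z : modc (- z) = modc z.
Proof. exact: normcN. Qed.

Lemma modcB z w : modc (z - w) = modc (w - z).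
Proof. by rewrite -modcN opprB. Qed.

Lemma modc_ge0 z : 0 <= modc z.
Proof. by case: z => a b; exact: sqrtr_ge0. Qed.

Lemma modc_real a : modc a%:C = `|a|.
Proof. by rewrite /modc /= expr0n /= addr0 sqrtr_sqr. Qed.

Lemma modci : modc ('i : R[i]) = 1.
Proof. by rewrite /modc /= expr0n expr1n /= add0r sqrtr1. Qed.

Lemma modc_sqr z : modc z ^+ 2 = Re z ^+ 2 + Im z ^+ 2.
Proof. by case: z => a b; rewrite /modc /= sqr_sqrtr ?addr_ge0 ?sqr_ge0. Qed.

Lemma modc_gt0 z : z != 0 -> 0 < modc z.
Proof.
move=> z0; rewrite lt0r modc_ge0 andbT; apply: contra z0 => /eqP.
by move/ComplexField.Normc.eq0_normc => ->.
Qed.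

Lemma modc_le_ReIm z : modc z <= `|Re z| + `|Im z|.
Proof.
rewrite -(@ler_pXn2r _ 2) ?nnegrE ?modc_ge0 ?addr_ge0 // modc_sqr.
rewrite sqrrD !real_normK ?num_real //.
by have := mulr_ge0 (normr_ge0 (Re z)) (normr_ge0 (Im z)); lra.
Qed.

Lemma modc_sum (I : Type) (r : seq I) (P : pred I) (F : I -> R[i]) :
  modc (\sum_(i <- r | P i) F i) <= \sum_(i <- r | P i) modc (F i).
Proof.
elim/big_ind2 : _ => [|z a w b za wb|//]; first by rewrite modc0.
exact: le_trans (modcD _ _) (lerD za wb).
Qed.

(** The real part of z times the conjugate of w. Imaginary parts are recovered by testing with
    ['i * z]. *)
Definition cdot z w : R := Re z * Re w + Im z * Im w.

Lemma cdotC z w : cdot z w = cdot w z.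
Proof. by rewrite /cdot (mulrC (Re z)) (mulrC (Im z)). Qed.

Lemma cdotDl z z' w : cdot (z + z') w = cdot z w + cdot z' w.
Proof. by case: z => a b; case: z' => c d; rewrite /cdot /=; ring. Qed.

Lemma cdotZl a z w : cdot (a%:C * z) w = a * cdot z w.
Proof. by case: z => b c; rewrite /cdot /=; ring. Qed.

Lemma cdotzz z : cdot z z = modc z ^+ 2.
Proof. by rewrite modc_sqr /cdot -!expr2. Qed.

Lemma cdot_mul_diag g z : cdot (g * z) z = Re g * modc z ^+ 2.
Proof. by rewrite -cdotzz; case: g => a b; case: z => c d; rewrite /cdot /=; ring. Qed.

Lemma cdot_mul_diag_i g z : cdot (g * z) ('i * z) = Im g * modc z ^+ 2.
Proof. by rewrite -cdotzz; case: g => a b; case: z => c d; rewrite /cdot /=; ring. Qed.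

End Modulus.

(** * Summation by parts for real sequences *)

Section SummationByParts.
Variable R : realType.
Implicit Types x z : nat -> R.

(** Boundary terms are kept so that induction on n goes through. If z vanishes at 0 and n+1, the
    remaining one is exactly the missing summand i = n of the gradient sum. *)
Lemma sum_by_parts x z n :
  \sum_(i < n) - (x i - 2 * x i.+1 + x i.+2) * z i.+1 =
  \sum_(i < n) (x i.+1 - x i) * (z i.+1 - z i)
  - (x n.+1 - x n) * z n + (x 1%N - x 0%N) * z 0%N.
Proof.
elim: n => [|n IH]; first by rewrite !big_ord0; ring.
by rewrite !big_ord_recr /= IH; ring.
Qed.

(** Abel summation of the products [x i * x i.+1] against the weights i+1. *)
Lemma sum_weighted_centered x n :
  \sum_(i < n) i.+1%:R * (x i.+2 - x i) * x i.+1 =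
  - \sum_(i < n) x i * x i.+1 + n%:R * (x n * x n.+1).
Proof.
elim: n => [|n IH]; first by rewrite !big_ord0; ring.
by rewrite !big_ord_recr /= IH -[n.+1%:R]natr1; ring.
Qed.

Lemma sqr_sum_le x n : (\sum_(i < n) x i) ^+ 2 <= n%:R * \sum_(i < n) x i ^+ 2.
Proof.
elim: n => [|n IH]; first by rewrite !big_ord0 expr0n mul0r.
rewrite !big_ord_recr /= -[n.+1%:R]natr1.
set S := \sum_(i < n) _ in IH *; set Q := \sum_(i < n) _ in IH *.
have [n0|n0] := posnP n.
  by rewrite /S /Q n0 !big_ord0; lra.
have npos : 0 < n%:R :> R by rewrite ltr0n.
(* Multiplied by n, the claim follows from [S ^+ 2 <= n%:R * Q] and a perfect square. *)
have : 0 <= n%:R * (Q + n%:R * x n ^+ 2 - 2 * S * x n).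
  have := sqr_ge0 (S - n%:R * x n); nra.
rewrite pmulr_rge0 //; lra.
Qed.

End SummationByParts.

(** * Inner product, norms and difference operators on the mesh *)

Section DiscreteSpace.
Variables (R : realType) (n : nat).
Local Notation J := n.+1.
Local Notation X := 'rV[R[i]]_(J.-1).
Local Notation h := (@hstep R J).
Implicit Types (v w : X) (c : R[i]) (a : R).

Lemma hstep_gt0 : 0 < h.
Proof. by rewrite /hstep invr_gt0 ltr0n. Qed.

Lemma hstep_sum1 : h * n%:R <= 1.
Proof. by rewrite /hstep mulrC ler_pdivrMr ?ltr0n // mul1r ler_nat. Qed.

Lemma entry0 v : entry v 0 = 0. Proof. by []. Qed.

Lemma entry_ord v (i : 'I_n) : entry v i.+1 = v 0 i.
Proof. by rewrite /entry insubT //= => ip; congr (v 0 _); exact: val_inj. Qed.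

Lemma entry_last v : entry v J = 0.
Proof. by rewrite /entry insubF //= ltnn. Qed.

Lemma entryD v w j : entry (v + w) j = entry v j + entry w j.
Proof.
case: j => [|j]; rewrite ?addr0 //= /entry.
by case: insubP => [i _ _|_] /=; rewrite ?mxE ?addr0.
Qed.

Lemma entryZ c v j : entry (c *: v) j = c * entry v j.
Proof.
case: j => [|j]; rewrite ?mulr0 //= /entry.
by case: insubP => [i _ _|_] /=; rewrite ?mxE ?mulr0.
Qed.

Lemma sum_entry (F : R[i] -> R) v :
  \sum_(1 <= j < J) F (entry v j) = \sum_(i < n) F (v 0 i).
Proof.
rewrite big_add1 big_mkord; apply: eq_bigr => i _; congr F; exact: entry_ord.
Qed.

Definition dot v w : R := h * \sum_i cdot (v 0 i) (w 0 i).

Lemma dotC v w : dot v w = dot w v.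
Proof. by rewrite /dot; congr (_ * _); apply: eq_bigr => i _; rewrite cdotC. Qed.

Lemma dotDl v v' w : dot (v + v') w = dot v w + dot v' w.
Proof.
rewrite /dot -mulrDr -big_split /=; congr (_ * _).
by apply: eq_bigr => i _; rewrite mxE cdotDl.
Qed.

Lemma dotDr v w w' : dot v (w + w') = dot v w + dot v w'.
Proof. by rewrite dotC dotDl !(dotC v). Qed.

Lemma dotZl a v w : dot (a%:C *: v) w = a * dot v w.
Proof.
rewrite /dot mulrCA; congr (_ * _); rewrite mulr_sumr.
by apply: eq_bigr => i _; rewrite mxE cdotZl.
Qed.

Lemma dotZr a v w : dot v (a%:C *: w) = a * dot v w.
Proof. by rewrite dotC dotZl dotC. Qed.

Lemma dotNl v w : dot (- v) w = - dot v w.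
Proof. by rewrite -mulN1r -dotZl rmorphN1 scaleN1r. Qed.

Lemma dotNr v w : dot v (- w) = - dot v w.
Proof. by rewrite dotC dotNl dotC. Qed.

Lemma norm0h_ge0 v : 0 <= norm0h v.
Proof. exact: sqrtr_ge0. Qed.

Lemma dot_ge0 v : 0 <= dot v v.
Proof.
rewrite /dot mulr_ge0 ?(ltW hstep_gt0) // sumr_ge0 // => i _.
by rewrite cdotzz sqr_ge0.
Qed.

Lemma norm0hE v : norm0h v = Num.sqrt (dot v v).
Proof.
rewrite /norm0h (sum_entry (fun z => modc z ^+ 2)) /dot; congr (Num.sqrt (_ * _)).
by apply: eq_bigr => i _; rewrite cdotzz.
Qed.

Lemma norm0h_sqr v : norm0h v ^+ 2 = dot v v.
Proof. by rewrite norm0hE sqr_sqrtr ?dot_ge0. Qed.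

Lemma norm0h_sqr_sum v : norm0h v ^+ 2 = h * \sum_i modc (v 0 i) ^+ 2.
Proof.
rewrite norm0h_sqr /dot; congr (_ * _).
by apply: eq_bigr => i _; rewrite cdotzz.
Qed.

Lemma norm0h_eq0 v : norm0h v = 0 -> v = 0.
Proof.
move=> v0; have := norm0h_sqr_sum v; rewrite v0 expr0n /= => /esym /eqP.
rewrite mulf_eq0 gt_eqF ?hstep_gt0 //= psumr_eq0; last by move=> i _; exact: sqr_ge0.
move=> /allP v0i; apply/rowP => i; rewrite mxE.
have := v0i i (mem_index_enum _); rewrite /= sqrf_eq0 => /eqP.
exact: ComplexField.Normc.eq0_normc.
Qed.

Lemma dot0l v : dot 0 v = 0.
Proof. by have := dotZl 0 0 v; rewrite mul0r scaler0. Qed.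

Lemma norm0h0 : norm0h (0 : X) = 0.
Proof. by rewrite norm0hE dot0l sqrtr0. Qed.

Lemma dot_le_norm v w : dot v w <= norm0h v * norm0h w.
Proof.
have [/norm0h_eq0 ->|v0] := eqVneq (norm0h v) 0.
  by rewrite dot0l norm0h0 mul0r.
have [/norm0h_eq0 ->|w0] := eqVneq (norm0h w) 0.
  by rewrite dotC dot0l norm0h0 mulr0.
have vpos : 0 < norm0h v by rewrite lt0r v0 norm0h_ge0.
have wpos : 0 < norm0h w by rewrite lt0r w0 norm0h_ge0.
have := dot_ge0 ((norm0h w)%:C *: v - (norm0h v)%:C *: w).
rewrite dotDl !dotDr !(dotNl, dotNr) !(dotZl, dotZr) -!norm0h_sqr (dotC w v) => H.
rewrite -subr_ge0 -(pmulr_rge0 _ (mulr_gt0 vpos wpos)).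
by move: H; nra.
Qed.

Lemma norm0hN v : norm0h (- v) = norm0h v.
Proof. by rewrite !norm0hE dotNl dotNr opprK. Qed.

Lemma norm0hD v w : norm0h (v + w) <= norm0h v + norm0h w.
Proof.
rewrite -(@ler_pXn2r _ 2) ?nnegrE ?addr_ge0 ?norm0h_ge0 // norm0h_sqr.
rewrite dotDl !dotDr -!norm0h_sqr (dotC w v).
by have := dot_le_norm v w; nra.
Qed.

Lemma norm0hB v w : norm0h (v - w) <= norm0h v + norm0h w.
Proof. by rewrite -(norm0hN w); exact: norm0hD. Qed.

Lemma norm0h_le (a : R) v w : 0 <= a ->
  (forall i, modc (v 0 i) <= a * modc (w 0 i)) -> norm0h v <= a * norm0h w.
Proof.
move=> a0 vw; rewrite -(@ler_pXn2r _ 2) ?nnegrE ?mulr_ge0 ?norm0h_ge0 //.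
rewrite exprMn !norm0h_sqr_sum mulrCA ler_wpM2l ?(ltW hstep_gt0) //.
rewrite mulr_sumr ler_sum // => i _; rewrite -exprMn.
by rewrite ler_pXn2r ?nnegrE ?mulr_ge0 ?modc_ge0.
Qed.

Lemma norm0hZ c v : norm0h (c *: v) = modc c * norm0h v.
Proof.
apply/eqP; rewrite -(@eqrXn2 _ 2) ?mulr_ge0 ?modc_ge0 ?norm0h_ge0 //.
rewrite exprMn !norm0h_sqr_sum mulrCA; apply/eqP; congr (_ * _).
by rewrite mulr_sumr; apply: eq_bigr => i _; rewrite mxE modcM exprMn.
Qed.

Lemma sum_modc_le_norm0h v : h * \sum_i modc (v 0 i) <= norm0h v.
Proof.
have h0 := ltW hstep_gt0.
rewrite -(@ler_pXn2r _ 2) ?nnegrE ?norm0h_ge0 ?mulr_ge0 ?sumr_ge0 //; last first.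
  by move=> i _; exact: modc_ge0.
have := sqr_sum_le (fun i => modc (entry v i.+1)) n.
under eq_bigr do rewrite entry_ord.
under [X in _ <= _ * X]eq_bigr do rewrite entry_ord.
rewrite norm0h_sqr_sum exprMn.
set S := \sum_(i < n) modc _; set Q := \sum_(i < n) _ => SQ.
have Q0 : 0 <= Q by apply: sumr_ge0 => i _; exact: sqr_ge0.
have := hstep_sum1; set k := h in h0 *; move: (n%:R : R) SQ => m SQ hm.
apply: (@le_trans _ _ (k ^+ 2 * (m * Q))); first by rewrite ler_wpM2l ?sqr_ge0.
have : 0 <= (1 - k * m) * (k * Q) by rewrite mulr_ge0 ?subr_ge0 ?mulr_ge0.
lra.
Qed.

Lemma modc_entry_le v j : (j <= J)%N ->
  modc (entry v j) <=
  h * \sum_(i < J) modc ((entry v i.+1 - entry v i) / h%:C).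
Proof.
move=> jJ.
have tele m : entry v m = \sum_(i < m) (entry v i.+1 - entry v i).
  elim: m => [|m IH]; first by rewrite big_ord0.
  by rewrite big_ord_recr /= -IH addrCA subrr addr0.
have -> : h * \sum_(i < J) modc ((entry v i.+1 - entry v i) / h%:C) =
          \sum_(i < J) modc (entry v i.+1 - entry v i).
  rewrite mulr_sumr; apply: eq_bigr => i _.
  rewrite modcM modcV modc_real gtr0_norm ?hstep_gt0 //.
  by rewrite mulrCA mulfV ?mulr1 // gt_eqF ?hstep_gt0.
rewrite tele; apply: le_trans (modc_sum _ _ _) _.
rewrite -(big_mkord xpredT (fun i => modc (entry v i.+1 - entry v i))).
rewrite -(big_mkord xpredT (fun i => modc (entry v i.+1 - entry v i))).
rewrite (big_cat_nat _ jJ) //= lerDl sumr_ge0 // => i _; exact: modc_ge0.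
Qed.

(** Every entry is a telescoping sum from [entry v 0 = 0], and h(J-1) is at most 1. The crude
    constant 1, valid on every mesh, shows that the set whose infimum is [CDPF] is nonempty. *)
Lemma norm0h_le_norm1h v : norm0h v <= norm1h v.
Proof.
have h0 := ltW hstep_gt0.
have hJ : h * J%:R = 1 by rewrite /hstep mulVf // pnatr_eq0.
rewrite -(@ler_pXn2r _ 2) ?nnegrE ?norm0h_ge0 ?sqrtr_ge0 //.
rewrite norm0h_sqr_sum /norm1h sqr_sqrtr; last first.
  by rewrite mulr_ge0 // sumr_ge0 // => i _; exact: sqr_ge0.
rewrite big_mkord.
set Q := h * \sum_(i < J) _.
have vQ j : (j <= J)%N -> modc (entry v j) ^+ 2 <= Q.
  move=> /(modc_entry_le v).
  have := sqr_sum_le (fun i => modc ((entry v i.+1 - entry v i) / h%:C)) J.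
  cbv beta.
  rewrite /Q; set P := \sum_(i < _) _; set S := \sum_(i < _) _ => SP vS.
  apply: (@le_trans _ _ ((h * S) ^+ 2)).
    have S0 := le_trans (modc_ge0 _) vS.
    rewrite ler_pXn2r ?nnegrE ?modc_ge0 //.
  rewrite exprMn.
  apply: (@le_trans _ _ (h ^+ 2 * (J%:R * P))); first by rewrite ler_wpM2l ?sqr_ge0.
  by rewrite expr2 -!mulrA (mulrA h J%:R) hJ mul1r.
have Q0 : 0 <= Q by apply: le_trans (vQ 0%N _); rewrite ?sqr_ge0.
apply: (@le_trans _ _ (h * \sum_(i < n) Q)).
  rewrite ler_wpM2l // ler_sum // => i _; rewrite -entry_ord; apply: vQ.
  exact: leqW (ltn_ord i).
rewrite sumr_const card_ord -mulr_natl mulrA ler_piMl //; exact: hstep_sum1.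
Qed.

Lemma norm1h_sqr v : norm1h v ^+ 2 =
  h^-1 * \sum_(i < J) modc (entry v i.+1 - entry v i) ^+ 2.
Proof.
rewrite /norm1h sqr_sqrtr; last first.
  by rewrite mulr_ge0 ?(ltW hstep_gt0) // sumr_ge0 // => i _; exact: sqr_ge0.
rewrite big_mkord !mulr_sumr; apply: eq_bigr => i _.
rewrite modcM modcV modc_real gtr0_norm ?hstep_gt0 //.
by have := hstep_gt0; rewrite exprMn => h0; field; rewrite gt_eqF.
Qed.

Let xRe v j := Re (entry v j).
Let xIm v j := Im (entry v j).

Lemma DeltahE v i : (Deltah v) 0 i = (h ^- 2)%:C *
  (entry v i - 2 * entry v i.+1 + entry v i.+2).
Proof. by rewrite mxE mulrC -rmorphXn -fmorphV. Qed.

Lemma dot_Deltah v : dot (- Deltah v) v = norm1h v ^+ 2.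
Proof.
rewrite norm1h_sqr /dot.
have E (i : 'I_n) : cdot ((- Deltah v) 0 i) (v 0 i) = h ^- 2 *
    (- (xRe v i - 2 * xRe v i.+1 + xRe v i.+2) * xRe v i.+1 +
     - (xIm v i - 2 * xIm v i.+1 + xIm v i.+2) * xIm v i.+1).
  rewrite mxE DeltahE -mulrN cdotZl -entry_ord /xRe /xIm /cdot; congr (_ * _).
  case: (entry v i) => a b; case: (entry v i.+1) => c d.
  by case: (entry v i.+2) => e f /=; ring.
rewrite (eq_bigr _ (fun i _ => E i)) -mulr_sumr big_split /= !sum_by_parts.
have F j : modc (entry v j.+1 - entry v j) ^+ 2 =
    (xRe v j.+1 - xRe v j) * (xRe v j.+1 - xRe v j) +
    (xIm v j.+1 - xIm v j) * (xIm v j.+1 - xIm v j).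
  by rewrite modc_sqr !raddfB !expr2.
under [in RHS]eq_bigr do rewrite F.
rewrite big_ord_recr /= big_split /= /xRe /xIm entry_last entry0 /=.
by have := hstep_gt0 => h0; field; rewrite gt_eqF.
Qed.

(** [Deltah] is real and symmetric, so the two cross sums of real and imaginary parts cancel.
    Testing with iv therefore isolates the imaginary part of the potential, and no Poincaré
    inequality enters there. *)
Lemma dot_Deltah_i v : dot (- Deltah v) ('i *: v) = 0.
Proof.
rewrite /dot.
have E (i : 'I_n) : cdot ((- Deltah v) 0 i) (('i *: v) 0 i) = h ^- 2 *
    (- (xIm v i - 2 * xIm v i.+1 + xIm v i.+2) * xRe v i.+1 -
     - (xRe v i - 2 * xRe v i.+1 + xRe v i.+2) * xIm v i.+1).
  rewrite !mxE -/(Deltah v) mulrC -rmorphXn -fmorphV -mulrN cdotZl -!entry_ord /xRe /xIm /cdot.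
  congr (_ * _); case: (entry v i) => a b; case: (entry v i.+1) => c d.
  by case: (entry v i.+2) => e f /=; ring.
rewrite (eq_bigr _ (fun i _ => E i)) -mulr_sumr sumrB /= !sum_by_parts.
have -> : \sum_(i < n) (xIm v i.+1 - xIm v i) * (xRe v i.+1 - xRe v i) =
          \sum_(i < n) (xRe v i.+1 - xRe v i) * (xIm v i.+1 - xIm v i).
  by apply: eq_bigr => i _; rewrite mulrC.
rewrite /xRe /xIm entry_last entry0 /=.
ring.
Qed.

Lemma sum_sqr_centered (x : nat -> R) : x 0%N = 0 -> x n.+1 = 0 ->
  \sum_(i < n) i.+1%:R * (x i.+2 - x i) * x i.+1 <= \sum_(i < n) x i.+1 ^+ 2.
Proof.
move=> x0 xJ; rewrite sum_weighted_centered xJ !mulr0 addr0 -sumrN.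
have : \sum_(i < n) - (x i * x i.+1) <=
       2^-1 * (\sum_(i < n) x i ^+ 2 + \sum_(i < n) x i.+1 ^+ 2).
  rewrite -big_split /= mulr_sumr ler_sum // => i _.
  by have := sqr_ge0 (x i + x i.+1); lra.
have : \sum_(i < n) x i ^+ 2 <= \sum_(i < n) x i.+1 ^+ 2.
  have : \sum_(i < n.+1) x i ^+ 2 = \sum_(i < n.+1) x i ^+ 2 by [].
  rewrite {1}big_ord_recl big_ord_recr /= x0 expr0n add0r => ->.
  by rewrite lerDl sqr_ge0.
lra.
Qed.

Definition transport v : X := otimes (omega J) (partialh v).

Lemma transportE v i : transport v 0 i =
  (i.+1%:R / 2)%:C * (entry v i.+2 - entry v i).
Proof.
have h0 : h != 0 by rewrite gt_eqF ?hstep_gt0.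
rewrite !mxE mulrCA mulrC; congr (_ * _).
rewrite /node; have : h%:C != 0 by rewrite fmorph_eq0.
move: h => k k0; rewrite [LHS]mulrC !rmorphM fmorphV !rmorph_nat /=.
by field.
Qed.

Lemma transportD v w : transport (v + w) = transport v + transport w.
Proof.
by apply/rowP => i; rewrite [RHS]mxE !transportE -mulrDr !entryD; congr (_ * _); ring.
Qed.

Lemma transportZ c v : transport (c *: v) = c *: transport v.
Proof.
by apply/rowP => i; rewrite [RHS]mxE !transportE !entryZ -mulrBr mulrCA.
Qed.

(** For y d/dy the left-hand side would be minus half the squared norm. On the mesh it is minus half
    a sum of products of neighbouring entries, whose sign is indefinite for oscillating v; hence the
    bound with the opposite sign, which suffices for a Gronwall argument. *)
Lemma dot_transport v : dot (transport v) v <= 2^-1 * norm0h v ^+ 2.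
Proof.
rewrite norm0h_sqr_sum /dot mulrCA ler_wpM2l ?(ltW hstep_gt0) //.
have -> : \sum_(i < n) cdot (transport v 0 i) (v 0 i) = 2^-1 *
    (\sum_(i < n) i.+1%:R * (xRe v i.+2 - xRe v i) * xRe v i.+1 +
     \sum_(i < n) i.+1%:R * (xIm v i.+2 - xIm v i) * xIm v i.+1).
  rewrite -big_split /= mulr_sumr; apply: eq_bigr => i _.
  rewrite transportE cdotZl -entry_ord /cdot !raddfB /= /xRe /xIm.
  by field.
have -> : \sum_(i < n) modc (v 0 i) ^+ 2 =
    \sum_(i < n) xRe v i.+1 ^+ 2 + \sum_(i < n) xIm v i.+1 ^+ 2.
  by rewrite -big_split /=; apply: eq_bigr => i _; rewrite -entry_ord modc_sqr.
rewrite ler_wpM2l ?invr_ge0 // lerD // sum_sqr_centered // /xRe /xIm ?entry_last //.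
Qed.

(* The differences of [w_j = y_j v_j] over two mesh widths are controlled by [transport v] and
   [v]; the odd indices can be started at [w_1 = h v_1]. *)
Lemma modc_omega_le v j : (j <= n)%N ->
  modc ((node J j)%:C * entry v j) <=
  \sum_(i < j.-1) 2 * h * modc (entry (transport v) i.+1)
  + \sum_(i < j) 2 * h * modc (entry v i) + h * modc (entry v j).
Proof.
have h0 := hstep_gt0.
elim/ltn_ind: j => -[|[|j]] IH jn.
- by rewrite entry0 mulr0 modc0 !big_ord0 !add0r mulr_ge0 // ltW.
- rewrite big_ord0 big_ord_recl big_ord0 entry0 modc0 /node mul1r modcM modc_real.
  by rewrite gtr0_norm // mulr0 !add0r.
have {IH} := IH j (leqnSn _) (ltnW (ltnW jn)).
have -> : (node J j.+2)%:C * entry v j.+2 = (node J j)%:C * entry v j +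
    ((2 * h)%:C * entry (transport v) j.+1 + h%:C * (entry v j.+2 + entry v j)).
  rewrite (entry_ord _ (Ordinal (ltnW jn))) transportE /= /node.
  move: (entry v j) (entry v j.+2) => [a b] [c d].
  rewrite -[j.+2%:R]natr1 -![j.+1%:R]natr1; apply/eqP; rewrite eq_complex /=.
  by apply/andP; split; apply/eqP; field.
move=> IH; apply: le_trans (modcD _ _) _; apply: le_trans (lerD IH (modcD _ _)) _.
rewrite !modcM !modc_real !gtr0_norm ?mulr_gt0 //.
have := ler_wpM2l (ltW h0) (modcD (entry v j.+2) (entry v j)).
rewrite [X in _ -> _ <= _ + X + _]big_ord_recr /= [X in _ -> _ <= _ + (X + _) + _]big_ord_recr /=.
have : \sum_(i < j.-1) 2 * h * modc (entry (transport v) i.+1) +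
       2 * h * modc (entry (transport v) j.+1) <=
       \sum_(i < j.+1) 2 * h * modc (entry (transport v) i.+1).
  rewrite big_ord_recr /= lerD2r; case: j {IH jn} => [//|j] /=.
  by rewrite big_ord_recr /= lerDl !mulr_ge0 ?modc_ge0 // ltW.
have : 0 <= 2 * h * modc (entry v j.+1) by rewrite !mulr_ge0 ?modc_ge0 // ltW.
lra.
Qed.

Lemma norminfh_omega_le v :
  norminfh (otimes (omega J) v) <= 2 * norm0h (transport v) + 2 * norm0h v.
Proof.
have h0 := ltW hstep_gt0.
rewrite /norminfh; elim/big_ind : _ => [|x y xb yb|j _]; first 2 last.
- have [jn|nj] := leqP j n; last first.
    case: j nj => [//|j] nj; rewrite /entry insubF ?modc0; last first.
      by apply/negbTE; rewrite -leqNgt.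
    by rewrite addr_ge0 // mulr_ge0 ?norm0h_ge0.
  have -> : entry (otimes (omega J) v) j = (node J j)%:C * entry v j.
    case: j jn => [|j jn]; first by rewrite mulr0.
    by rewrite !(entry_ord _ (Ordinal jn)) !mxE.
  apply: le_trans (modc_omega_le v jn) _.
  have sumle (w : X) m : (m <= n)%N ->
      \sum_(i < m) 2 * h * modc (entry w i.+1) <= 2 * norm0h w.
    move=> mn; apply: le_trans (_ : 2 * (h * \sum_(i < n) modc (w 0 i)) <= _); last first.
      by rewrite ler_wpM2l // sum_modc_le_norm0h.
    rewrite mulrA mulr_sumr.
    under [X in _ <= X]eq_bigr do rewrite -entry_ord.
    rewrite -(big_mkord xpredT (fun i => 2 * h * modc (entry w i.+1))).
    rewrite -(big_mkord xpredT (fun i => 2 * h * modc (entry w i.+1))).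
    rewrite (big_cat_nat _ mn) //= lerDl sumr_ge0 // => i _.
    by rewrite !mulr_ge0 ?modc_ge0.
  rewrite -addrA lerD ?sumle ?(leq_trans (leq_pred _)) //.
  case: j jn => [|j jn].
    by rewrite big_ord0 entry0 modc0 mulr0 addr0 mulr_ge0 ?norm0h_ge0.
  apply: le_trans (sumle v _ jn).
  (* The summand of index 0 vanishes; after the shift the last summand is free, and its [2 * h]
     absorbs the extra term [h * modc (entry v j.+1)]. *)
  rewrite big_ord_recl entry0 modc0 mulr0 add0r.
  under eq_bigr do rewrite lift0.
  rewrite [X in _ <= X]big_ord_recr /= lerD2l -mulrA ler_peMl ?mulr_ge0 ?modc_ge0 //.
  by rewrite ler1n.
- by rewrite addr_ge0 // mulr_ge0 ?norm0h_ge0.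
- by rewrite ge_max xb yb.
Qed.

End DiscreteSpace.

(** * Stability of T_h *)

Section ResolventBounds.
Variables (R : realType).

Lemma CDPF_ge0 : 0 <= CDPF R.
Proof.
apply: lb_le_inf => [|C []//]; exists 1; split=> // -[//|n] v _.
by rewrite mul1r norm0h_le_norm1h.
Qed.

(** The infimum is itself admissible: for fixed v with nonzero [norm1h v], the quotient of the two
    norms is a lower bound of the set of admissible constants. *)
Lemma norm0h_le_CDPF n (v : 'rV[R[i]]_(n.+1.-1)) : (2 <= n)%N ->
  norm0h v <= CDPF R * norm1h v.
Proof.
move=> n2; have v1 : 0 <= norm1h v by exact: sqrtr_ge0.
have [v0|vN0] := eqVneq (norm1h v) 0.
  by rewrite v0 mulr0 -v0 norm0h_le_norm1h.
rewrite -ler_pdivrMr ?lt0r ?vN0 //.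
apply: lb_le_inf => [|C [C0 HC]].
  by exists 1; split=> // -[//|m] w _; rewrite mul1r norm0h_le_norm1h.
by rewrite ler_pdivrMr ?lt0r ?vN0 //; exact: HC.
Qed.

(* When [CDPF R = 0] the left-hand side is 0, because [1 / 0 = 0]. *)
Lemma CDPF_norm1h n (v : 'rV[R[i]]_(n.+1.-1)) : (2 <= n)%N ->
  1 / CDPF R ^+ 2 * norm0h v ^+ 2 <= norm1h v ^+ 2.
Proof.
move=> n2; have [->|C0] := eqVneq (CDPF R) 0.
  by rewrite expr0n invr0 mulr0 mul0r sqr_ge0.
have Cpos : 0 < CDPF R by rewrite lt0r C0 CDPF_ge0.
rewrite mul1r mulrC ler_pdivrMr ?exprn_gt0 // mulrC -exprMn.
by rewrite ler_pXn2r ?nnegrE ?mulr_ge0 ?norm0h_ge0 ?sqrtr_ge0 ?CDPF_ge0 ?norm0h_le_CDPF.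
Qed.

(** [inf] takes the default value 0 on a set without infimum, so positivity already forces the set
    to be bounded below. *)
Lemma inf_gt0_lb (E : set R) x : 0 < inf E -> E x -> inf E <= x.
Proof.
move=> E0; apply: ge_inf.
by apply: contrapT => H; move: E0; rewrite inf_out ?ltxx // => -[].
Qed.

Variables (rmax alpha : R) (q : R[i]) (s : R -> R) (beta : R * R -> R[i]).
Hypotheses (halpha : 0 < alpha) (hq : q != 0).

Definition potential (r y : R) : R[i] :=
  (s r)%:C ^+ 2 * ((1 + q * gam s beta r y) / (alpha%:C ^+ 2 * q)).

Lemma potentialE r y :
  potential r y = (s r ^+ 2 / alpha ^+ 2)%:C * (q^-1 + gam s beta r y).
Proof.
have a0 : alpha%:C != 0 by rewrite fmorph_eq0 gt_eqF.
rewrite /potential rmorphM fmorphV !rmorphXn /=.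
by field; rewrite a0 hq.
Qed.

(** Since 1/q is the conjugate of q divided by its squared modulus, this is the expression under the
    infimum in the first alternative of the hypothesis. *)
Lemma Re_potential r y : Re (potential r y) =
  s r ^+ 2 / (alpha ^+ 2 * modc q ^+ 2)
    * (Re q + modc q ^+ 2 * Re (gam s beta r y)).
Proof.
rewrite potentialE; have : 0 < modc q ^+ 2 by rewrite exprn_gt0 ?modc_gt0.
rewrite modc_sqr; case: q => a b; case: (gam s beta r y) => c d /= ab.
by have := halpha => a0; field; rewrite !gt_eqF.
Qed.

Lemma Im_potential r y : Im (potential r y) =
  - (s r ^+ 2 / (alpha ^+ 2 * modc q ^+ 2)
    * (Im q - modc q ^+ 2 * Im (gam s beta r y))).
Proof.
rewrite potentialE; have : 0 < modc q ^+ 2 by rewrite exprn_gt0 ?modc_gt0.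
rewrite modc_sqr; case: q => a b; case: (gam s beta r y) => c d /= ab.
by have := halpha => a0; field; rewrite !gt_eqF.
Qed.

Section FixedMesh.
Variable n : nat.
Local Notation J := n.+1.
Local Notation X := 'rV[R[i]]_(J.-1).
Local Notation h := (@hstep R J).
Local Notation L r := (@Lambdah R J alpha q s beta r).
Local Notation T r := (@Th R J alpha q s beta r).
Implicit Types v w : X.

Lemma LambdahE r v i :
  L r v 0 i = (- Deltah v) 0 i - potential r (node J i.+1) * v 0 i.
Proof. by rewrite /Lambdah !mxE. Qed.

Lemma Lambdah_is_linear r : linear (L r).
Proof.
move=> c v w; apply/rowP => i; rewrite /Lambdah !mxE.
by rewrite !entryD !entryZ; ring.
Qed.

HB.instance Definition _ r :=
  GRing.isLinear.Build R[i] X X *:%R (L r) (Lambdah_is_linear r).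

Lemma dot_Lambdah r v : dot (L r v) v = norm1h v ^+ 2
  - h * \sum_(i < n) Re (potential r (node J i.+1)) * modc (v 0 i) ^+ 2.
Proof.
rewrite -dot_Deltah /dot -mulrBr -sumrB; congr (_ * _); apply: eq_bigr => i _.
by rewrite LambdahE cdotDl -mulNr cdot_mul_diag raddfN mulNr.
Qed.

Lemma dot_Lambdah_i r v : dot (L r v) ('i *: v) = 0
  - (h * \sum_(i < n) Im (potential r (node J i.+1)) * modc (v 0 i) ^+ 2).
Proof.
rewrite -[X in X - _](dot_Deltah_i v) /dot -mulrBr -sumrB; congr (_ * _).
apply: eq_bigr => i _.
rewrite LambdahE cdotDl [('i *: v) 0 i]mxE -mulNr cdot_mul_diag_i raddfN mulNr //.
Qed.

Lemma node_itv (i : 'I_n) : 0 < (node J i.+1 : R) < 1.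
Proof.
rewrite /node; apply/andP; split; first by rewrite mulr_gt0 ?hstep_gt0 ?ltr0n.
by rewrite /hstep ltr_pdivrMr ?ltr0n // mul1r ltr_nat ltnS.
Qed.

(** The lower bound makes the kernel trivial, hence the square matrix invertible. Only then is
    [invmx], which returns a singular matrix unchanged, a true inverse. *)
Lemma Lambdah_bounded_below m : 0 < m ->
  (forall r v, 0 <= r <= rmax -> m * norm0h v ^+ 2 <= norm0h (L r v) * norm0h v) ->
  forall r, 0 <= r <= rmax ->
  (forall v, L r (T r v) = v) /\ forall v, norm0h v <= m^-1 * norm0h (L r v).
Proof.
move=> m0 Hm r rI.
have below v : m * norm0h v <= norm0h (L r v).
  have [v0|v0] := eqVneq (norm0h v) 0; first by rewrite v0 mulr0 norm0h_ge0.
  by rewrite -(@ler_pM2r _ (norm0h v)) ?lt0r ?v0 ?norm0h_ge0 // -mulrA -expr2 Hm.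
have LE v : v *m lin1_mx (L r) = L r v by rewrite mul_rV_lin1.
have LT v : L r (T r v) = v.
  rewrite -LE /Th mulmxKV // -row_free_unit; apply: inj_row_free => w.
  rewrite LE => Lw; apply: norm0h_eq0; apply/eqP; rewrite eq_le norm0h_ge0 andbT.
  by rewrite -(pmulr_rle0 _ m0) (le_trans (below w)) // Lw norm0h0.
by split=> // v; rewrite ler_pdivlMl.
Qed.

End FixedMesh.

Hypothesis hcond :
      0 < inf [set 1 / CDPF R ^+ 2
                   - s x.1 ^+ 2 / (alpha ^+ 2 * modc q ^+ 2)
                     * (Re q + modc q ^+ 2 * Re (gam s beta x.1 x.2))
              | x in Omega rmax]
      \/
      exists dstar : R, (dstar = 1 \/ dstar = -1) /\
        0 < inf [set dstar * s x.1 ^+ 2 / (alpha ^+ 2 * modc q ^+ 2)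
                     * (Im q - modc q ^+ 2 * Im (gam s beta x.1 x.2))
                | x in Omega rmax].

Lemma node_Omega n (i : 'I_n) r : 0 <= r <= rmax -> Omega rmax (r, node n.+1 i.+1).
Proof. by move=> rI; have /andP[a b] := node_itv i; split=> //=; rewrite !ltW. Qed.

(** The first alternative is tested with v and uses the Poincaré-Friedrichs inequality, the second
    with [dstar] times iv. The conclusion is phrased with a product of norms because the test vector
    differs between the two cases while its norm does not. *)
Lemma Lambdah_coercive : exists2 m, 0 < m &
  forall n r (v : 'rV[R[i]]_(n.+1.-1)), (2 <= n)%N -> 0 <= r <= rmax ->
  m * norm0h v ^+ 2 <= norm0h (Lambdah alpha q s beta r v) * norm0h v.
Proof.
case: hcond => [H|[d [d1 H]]].
  move: H; set m := inf _ => m0; exists m => // n r v n2 rI.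
  apply: le_trans (dot_le_norm _ _); rewrite dot_Lambdah.
  apply: le_trans (lerB (CDPF_norm1h v n2) (lexx _)).
  rewrite norm0h_sqr_sum mulrCA [1 / _ * _]mulrCA -mulrBr ler_wpM2l ?(ltW (hstep_gt0 _ _)) //.
  rewrite !mulr_sumr -sumrB ler_sum // => i _.
  rewrite -mulrBl ler_wpM2r ?sqr_ge0 // Re_potential; apply: inf_gt0_lb => //.
  by exists (r, node n.+1 i.+1) => //; exact: node_Omega.
move: H; set m := inf _ => m0; exists m => // n r v n2 rI.
(* The norm of v is replaced by that of the test vector for Cauchy-Schwarz, and restored
   afterwards. *)
have -> : norm0h v = norm0h (d%:C *: ('i *: v)).
  by rewrite !norm0hZ modci mul1r modc_real; case: d1 => ->; rewrite ?normrN normr1 mul1r.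
apply: le_trans (dot_le_norm _ _); rewrite dotZr dot_Lambdah_i sub0r.
have -> : norm0h (d%:C *: ('i *: v)) = norm0h v.
  by rewrite !norm0hZ modci mul1r modc_real; case: d1 => ->; rewrite ?normrN normr1 mul1r.
rewrite norm0h_sqr_sum mulrCA mulrN -mulNr [X in _ <= X]mulrCA ler_wpM2l ?(ltW (hstep_gt0 _ _)) //.
rewrite !mulr_sumr ler_sum // => i _.
rewrite [X in _ <= X]mulrA ler_wpM2r ?sqr_ge0 // Im_potential mulrNN; apply: inf_gt0_lb => //.
by exists (r, node n.+1 i.+1) => //=; [exact: node_Omega | rewrite !mulrA].
Qed.

(** The quantifiers over n and r lie inside, so one C serves all meshes and ranges. Here J = n+1,
    and [2 <= n] means J at least 3. *)
Definition stable_resolvent (C : R) := forall n r, (2 <= n)%N -> 0 <= r <= rmax ->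
  (forall v : 'rV[R[i]]_(n.+1.-1),
     Lambdah alpha q s beta r (Th alpha q s beta r v) = v) /\
  (forall v : 'rV[R[i]]_(n.+1.-1),
     norm0h v <= C * norm0h (Lambdah alpha q s beta r v)).

Lemma Th_stable : exists2 C, 0 <= C & stable_resolvent C.
Proof.
have [m m0 Hm] := Lambdah_coercive.
exists m^-1; first by rewrite invr_ge0 ltW.
by move=> n r n2; apply: Lambdah_bounded_below => // r' v rI; exact: Hm.
Qed.

Lemma Th_bounded C n r (v : 'rV[R[i]]_(n.+1.-1)) : stable_resolvent C ->
  (2 <= n)%N -> 0 <= r <= rmax ->
  norm0h (Th alpha q s beta r v) <= C * norm0h v.
Proof.
move=> HT n2 rI; have [LT Lb] := HT n r n2 rI.
by apply: le_trans (Lb _) _; rewrite LT.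
Qed.

(* Resolvent identity: T - T' = T (Lambda' - Lambda) T'. *)
Lemma Th_lipschitz C Lp n r r' (v : 'rV[R[i]]_(n.+1.-1)) : 0 <= C -> 0 <= Lp ->
  stable_resolvent C -> (2 <= n)%N -> 0 <= r <= rmax -> 0 <= r' <= rmax ->
  (forall y, 0 < y < 1 -> modc (potential r y - potential r' y) <= Lp) ->
  norm0h (Th alpha q s beta r v - Th alpha q s beta r' v) <= C ^+ 2 * Lp * norm0h v.
Proof.
move=> C0 Lp0 HT n2 rI rI' Hp.
have [LT Lb] := HT n r n2 rI; have [LT' Lb'] := HT n r' n2 rI'.
have Tb' := Th_bounded v HT n2 rI'.
apply: le_trans (Lb _) _; rewrite linearB /= LT -{1}(LT' v).
set x := Th _ _ _ _ r' v in Tb' *.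
rewrite expr2 -!mulrA ler_wpM2l //.
apply: (@le_trans _ _ (Lp * norm0h x)); last by rewrite mulrCA ler_wpM2l.
apply: norm0h_le => // i.
have mxB (a b : 'rV[R[i]]_(n.+1.-1)) : (a - b) 0 i = a 0 i - b 0 i by rewrite !mxE.
rewrite mxB !LambdahE.
have -> : (- Deltah x) 0 i - potential r' (node n.+1 i.+1) * x 0 i -
    ((- Deltah x) 0 i - potential r (node n.+1 i.+1) * x 0 i) =
    (potential r (node n.+1 i.+1) - potential r' (node n.+1 i.+1)) * x 0 i by ring.
by rewrite modcM ler_wpM2r ?modc_ge0 // Hp // node_itv.
Qed.

End ResolventBounds.

(** * Regularity of the coefficients *)

Section WithinDerivatives.
Variable R : realType.
Implicit Types (a b x : R) (f : R -> R).

Lemma within_quotient_continuous (D : set R) f :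
  (forall x, D x -> cvg (within_quotient D f x)) -> {within D, continuous f}.
Proof.
move=> Df; apply/subspace_continuousP => x Dx.
have gl := Df x Dx.
set g := fun t => (f t - f x) / (t - x).
have gl' : g t @[t --> within D x^'] --> lim (within_quotient D f x) by exact: gl.
have sub : within D x^' --> x.
  by move=> P Px; apply: (filterS _ Px) => t Pt _ _.
have tx : (t - x) @[t --> within D x^'] --> 0.
  by rewrite -(subrr x); apply: cvgB => //; exact: cvg_cst.
have fx : (f x + g t * (t - x)) @[t --> within D x^'] --> f x.
  rewrite -[X in _ --> X]addr0 -[X in _ --> _ + X](mulr0 (lim (within_quotient D f x))).
  by apply: cvgD; [exact: cvg_cst|exact: cvgM].
apply/cvgrPdist_lt => e e0.
have fxe : nbhs x (fun t => t != x -> D t -> `|f x - (f x + g t * (t - x))| < e).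
  by move/cvgrPdist_lt : fx; exact.
suff : nbhs x (fun t => D t -> `|f x - f t| < e) by [].
apply: filterS fxe => t Ht Dt.
have [->|tx0] := eqVneq t x; first by rewrite subrr normr0.
have := Ht tx0 Dt; rewrite /g divfK ?subr_eq0 //.
by rewrite [X in _ - X]addrCA subrr addr0.
Qed.

(** At an interior point the relative derivative is the ordinary one, which is the form the mean
    value theorem asks for. *)
Lemma within_quotient_is_derive a b f x : x \in `]a, b[ ->
  cvg (within_quotient `[a, b] f x) ->
  is_derive x 1 f (within_derive `[a, b] f x).
Proof.
move=> xab /cvgrPdist_lt gl.
have H : h^-1 *: (f (h *: 1 + x) - f x) @[h --> 0^'] -->
    within_derive `[a, b] f x.
  apply/cvgrPdist_lt => e e0.
  have G : nbhs x (fun t => t != x -> `[a, b]%classic t ->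
      `|within_derive `[a, b] f x - (f t - f x) / (t - x)| < e) by exact: gl.
  have {}G : \forall t \near x, t != x ->
      `|within_derive `[a, b] f x - (f t - f x) / (t - x)| < e.
    have xn : nbhs x (fun t => t \in `]a, b[) by exact: near_in_itvoo.
    apply: filterS2 xn G => t tab Gt tx; apply: Gt => //.
    exact: subset_itv_oo_cc.
  move: G; rewrite (near_shift 0 x) subr0 /= => G.
  apply: filterS G => h Gh h0.
  have := Gh; rewrite /shift /= addrK -subr_eq0 addrK => /(_ h0).
  by rewrite [h *: 1]mulr1 mulrC.
apply: DeriveDef; first by apply/cvg_ex; eexists; exact: H.
exact: cvg_lim H.
Qed.

Lemma within_quotient_mvt a b f x y :
  (forall x, x \in `[a, b] -> cvg (within_quotient `[a, b] f x)) ->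
  a <= x -> x <= y -> y <= b ->
  exists2 c, c \in `[a, b] & f y - f x = within_derive `[a, b] f c * (y - x).
Proof.
move=> Df ax xy yb.
have sub : {subset `[x, y] <= `[a, b]}.
  by apply/subitvP; rewrite subitvE !bnd_simp ax yb.
have [||c cxy E] := @MVT_segment _ f (within_derive `[a, b] f) x y xy.
- move=> t; rewrite in_itv /= => /andP[xt ty].
  apply: within_quotient_is_derive; last first.
    by apply: Df; rewrite in_itv /= (le_trans ax (ltW xt)) (le_trans (ltW ty) yb).
  by rewrite in_itv /= (le_lt_trans ax xt) (lt_le_trans ty yb).
- apply: continuous_subspaceW (within_quotient_continuous Df).
  by move=> t /= /sub.
- by exists c => //; exact: sub.
Qed.

Lemma within_continuous_bounded (T : topologicalType) (D : set T) (f : T -> R) :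
  compact D -> {within D, continuous f} ->
  exists2 B, 0 <= B & forall x : T, D x -> `|f x| <= B.
Proof.
move=> cD cf; have [M [_ HM]] := compact_bounded (continuous_compact cf cD).
exists (`|M| + 1) => [|x Dx]; first by rewrite addr_ge0.
apply: (HM (`|M| + 1)); last by exists x.
by rewrite ltr_pwDr // ler_norm.
Qed.

Lemma within_quotient_lipschitz a b f :
  (forall x, x \in `[a, b] -> cvg (within_quotient `[a, b] f x)) ->
  {within `[a, b], continuous (within_derive `[a, b] f)} ->
  exists2 L, 0 <= L &
    forall x y, x \in `[a, b] -> y \in `[a, b] -> `|f x - f y| <= L * `|x - y|.
Proof.
move=> Df cf; have [L L0 HL] := within_continuous_bounded (@segment_compact _ _ _) cf.
exists L => // x y; wlog xy : x y / x <= y.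
  move=> H xab yab; have [xy|/ltW yx] := leP x y; first exact: H.
  by rewrite distrC (distrC x); exact: H.
rewrite !in_itv /= => /andP[ax xb] /andP[ay yb].
have [c cab E] := within_quotient_mvt Df ax xy yb.
by rewrite distrC E normrM (distrC x) ler_wpM2r //; exact: HL.
Qed.

End WithinDerivatives.

Lemma is_derive_mvt (R : realType) (f df : R -> R) (a b : R) : a <= b ->
  (forall t : R, t \in `[a, b] -> is_derive t 1 f (df t)) ->
  exists2 c : R, c \in `[a, b] & f b - f a = df c * (b - a).
Proof.
move=> ab D.
have fc : {within `[a, b], continuous f}.
  apply: derivable_within_continuous => t tab.
  exact: (@ex_derive _ _ _ _ _ _ _ (D t tab)).
have D' : forall t : R, t \in `]a, b[ -> is_derive t 1 f (df t).
  by move=> t tab; have tab' := subset_itv_oo_cc tab; exact: (D t tab').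
exact: (@MVT_segment R f df a b ab D' fc).
Qed.

(** * The boundary curve s and the region below it *)

Section Range.
Variables (R : realType) (rmax : R) (s : R -> R).
Hypotheses (hrmax : 0 < rmax) (hs_smooth : smooth1 `[0, rmax] s).
Hypotheses (hs_pos : forall r, 0 <= r <= rmax -> 0 < s r).
Hypotheses (hs_dot : forall r, 0 <= r <= rmax -> 0 < sdot rmax s r).

Lemma s_quotient x : x \in `[0, rmax] -> cvg (within_quotient `[0, rmax] s x).
Proof. by move=> xI; exact: (@hs_smooth 0%N x xI). Qed.

Lemma sdot_quotient x : x \in `[0, rmax] ->
  cvg (within_quotient `[0, rmax] (sdot rmax s) x).
Proof. by move=> xI; exact: (@hs_smooth 1%N x xI). Qed.

Lemma sddot_quotient x : x \in `[0, rmax] ->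
  cvg (within_quotient `[0, rmax] (within_derive `[0, rmax] (sdot rmax s)) x).
Proof. by move=> xI; exact: (@hs_smooth 2%N x xI). Qed.

Lemma s_continuous : {within `[0, rmax], continuous s}.
Proof. exact: within_quotient_continuous s_quotient. Qed.

Lemma s_homo r r' : 0 <= r -> r <= r' -> r' <= rmax -> s r <= s r'.
Proof.
move=> r0 rr r'R.
have [c] := within_quotient_mvt s_quotient r0 rr r'R.
rewrite in_itv /= => cI E.
by rewrite -subr_ge0 E mulr_ge0 ?subr_ge0 // ltW // hs_dot.
Qed.

Lemma s_lipschitz : exists2 L, 0 <= L &
  forall r r', r \in `[0, rmax] -> r' \in `[0, rmax] -> `|s r - s r'| <= L * `|r - r'|.
Proof.
apply: within_quotient_lipschitz; first exact: s_quotient.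
exact: within_quotient_continuous sdot_quotient.
Qed.

Lemma sdot_lipschitz : exists2 L, 0 <= L &
  forall r r', r \in `[0, rmax] -> r' \in `[0, rmax] ->
  `|sdot rmax s r - sdot rmax s r'| <= L * `|r - r'|.
Proof.
apply: within_quotient_lipschitz; first exact: sdot_quotient.
exact: within_quotient_continuous sddot_quotient.
Qed.

(** The change of variables (r, y) to (r, y s(r)) maps a compact rectangle continuously onto the
    region; it is inverted by dividing by the positive s(r). *)
Lemma calD_compact : compact (calD rmax s).
Proof.
pose phi (x : R * R) := (x.1, x.2 * s x.1).
have -> : calD rmax s = phi @` (`[0, rmax] `*` `[0, 1]).
  apply/seteqP; split => [[r z] [/= rI /andP[z0 zs]]|_ [[r y] [/= rI yI] <-]].
    have s0 := hs_pos rI; exists (r, z / s r); last first.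
      by rewrite /phi /= divfK ?gt_eqF.
    split=> /=; rewrite in_itv //=.
    by rewrite divr_ge0 ?(ltW s0) //= ler_pdivrMr // mul1r.
  rewrite !in_itv /= in rI yI; case/andP: yI => y0 y1; split=> //=.
  by rewrite mulr_ge0 ?(ltW (hs_pos rI)) //= ler_piMl // ltW // hs_pos.
apply: continuous_compact; last by apply: compact_setX; exact: segment_compact.
apply/subspace_continuousP => -[r y] [/= rI yI].
have fst_cvg : x.1 @[x --> within (`[0, rmax] `*` `[0, 1]) (nbhs (r, y))] --> r.
  by apply: cvg_within_filter; exact: cvg_fst.
have snd_cvg : x.2 @[x --> within (`[0, rmax] `*` `[0, 1]) (nbhs (r, y))] --> y.
  by apply: cvg_within_filter; exact: cvg_snd.
suff s_cvg : s x.1 @[x --> within (`[0, rmax] `*` `[0, 1]) (nbhs (r, y))] --> s r.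
  exact: (cvg_pair fst_cvg (cvgM snd_cvg s_cvg)).
have sc : s t @[t --> within `[0, rmax] (nbhs r)] --> s r.
  by have /subspace_continuousP := s_continuous; exact.
apply: (cvg_comp fst s _ sc) => P P1.
have P2 : nbhs r (fun t => `[0, rmax]%classic t -> P t) by exact: P1.
suff : nbhs (r, y) (fun x : R * R => (`[0, rmax] `*` `[0, 1])%classic x -> P x.1) by [].
have P3 : nbhs (r, y) (fun x : R * R => `[0, rmax]%classic x.1 -> P x.1).
  by have f1 : x.1 @[x --> nbhs (r, y)] --> r by [exact: cvg_fst]; exact: (f1 _ P2).
by apply: filterS P3 => x Px [x1 _]; exact: Px.
Qed.

(** [Cm_upto] provides partial derivatives only in the interior, so the segments used for the mean
    value theorem have to be placed there. *)
Lemma calD_interior r z : 0 < r -> r < rmax -> 0 < z -> z < s r ->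
  (calD rmax s)° (r, z).
Proof.
move=> r0 rR z0 zs.
have rI : r \in `]0, rmax[ by rewrite in_itv /= r0.
have sc : {for r, continuous s} by exact: within_continuous_continuous s_continuous rI.
have fst_cvg : x.1 @[x --> nbhs (r, z)] --> r by exact: cvg_fst.
have snd_cvg : x.2 @[x --> nbhs (r, z)] --> z by exact: cvg_snd.
have s_cvg : s x.1 - x.2 @[x --> nbhs (r, z)] --> s r - z.
  by apply: cvgB => //; exact: (cvg_comp fst s fst_cvg sc).
rewrite /interior /=.
have n1 : \forall x \near (r, z), 0 < x.1 by exact: (cvgr_gt _ fst_cvg).
have n2 : \forall x \near (r, z), x.1 < rmax by exact: (cvgr_lt _ fst_cvg).
have n3 : \forall x \near (r, z), 0 < x.2 by exact: (cvgr_gt _ snd_cvg).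
have n4 : \forall x \near (r, z), 0 < s x.1 - x.2.
  by apply: (cvgr_gt _ s_cvg); rewrite subr_gt0.
near=> x; rewrite /calD /=; split; apply/andP; split; apply: ltW.
- by near: x.
- by near: x.
- by near: x.
- by rewrite -subr_gt0; near: x.
Unshelve. all: by end_near. Qed.

(* [(r, y s(r))] and [(r', y s(r'))] are joined inside the region by a horizontal and then a
   vertical segment, because s is nondecreasing. *)
Lemma Cm_upto_lipschitz (f : R * R -> R) : Cm_upto 1 (calD rmax s) f ->
  exists2 B, 0 <= B & forall y r r', 0 < y < 1 -> 0 < r < rmax -> 0 < r' < rmax ->
    `|f (r, y * s r)| <= B /\
    `|f (r, y * s r) - f (r', y * s r')| <= B * `|r - r'|.
Proof.
move=> [F [Ff Fc Fd]].
have [B0 B00 H0] := within_continuous_bounded calD_compact (Fc 0%N 0%N isT).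
have [B1 B10 H1] := within_continuous_bounded calD_compact (Fc 1%N 0%N isT).
have [B2 B20 H2] := within_continuous_bounded calD_compact (Fc 0%N 1%N isT).
have [L L0 HL] := s_lipschitz.
have mem r z : 0 < r < rmax -> 0 < z < s r -> (calD rmax s)° (r, z).
  by move=> /andP[r0 rR] /andP[z0 zs]; exact: calD_interior.
exists (B0 + (B1 + B2 * L)); first by rewrite !addr_ge0 ?mulr_ge0.
move=> y r r' yI rI r'I.
have curve t : 0 < t < rmax -> 0 < y * s t < s t.
  case/andP: yI => y0 y1 /andP[t0 tR].
  have s0 : 0 < s t by rewrite hs_pos // !ltW.
  by rewrite mulr_gt0 //= gtr_pMl.
have Dcurve t : 0 < t < rmax -> calD rmax s (t, y * s t).
  by move=> tI; apply: interior_subset; apply: mem => //; exact: curve.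
split.
  rewrite -(Ff _ (Dcurve _ rI)); apply: le_trans (H0 _ (Dcurve _ rI)) _.
  by rewrite lerDl addr_ge0 ?mulr_ge0.
wlog rr : r r' rI r'I / r <= r'.
  move=> H; have [rr|/ltW rr] := leP r r'; first exact: H.
  by rewrite distrC (distrC r); exact: H.
rewrite -(Ff _ (Dcurve _ rI)) -(Ff _ (Dcurve _ r'I)).
have [r0 rR] := andP rI; have [r'0 r'R] := andP r'I.
have [y0 y1] := andP yI.
have ss : s r <= s r' by apply: s_homo => //; exact: ltW.
have [z0 zs] := andP (curve r rI).
have horizontal : `|F 0%N 0%N (r', y * s r) - F 0%N 0%N (r, y * s r)| <= B1 * `|r - r'|.
  have inI t : t \in `[r, r'] -> (calD rmax s)° (t, y * s r).
    rewrite in_itv /= => /andP[rt tr']; apply: mem.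
      by rewrite (lt_le_trans r0 rt) (le_lt_trans tr' r'R).
    rewrite z0 (lt_le_trans zs) // s_homo // ltW //.
    exact: le_lt_trans tr' r'R.
  have D (t : R) : t \in `[r, r'] ->
      is_derive t 1 (fun t => F 0%N 0%N (t, y * s r)) (F 1%N 0%N (t, y * s r)).
    by move=> /inI /(Fd 0%N 0%N _ isT) [].
  have [c cI E] := is_derive_mvt rr D.
  rewrite E normrM (distrC r) ler_wpM2r // H1 //.
  exact: interior_subset (inI c cI).
have vertical : `|F 0%N 0%N (r', y * s r') - F 0%N 0%N (r', y * s r)| <=
    B2 * L * `|r - r'|.
  have zz : y * s r <= y * s r' by rewrite ler_pM2l.
  have inI t : t \in `[y * s r, y * s r'] -> (calD rmax s)° (r', t).
    rewrite in_itv /= => /andP[rt tr']; apply: mem => //.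
    by rewrite (lt_le_trans z0 rt) (le_lt_trans tr') //; have [] := andP (curve r' r'I).
  have D (t : R) : t \in `[y * s r, y * s r'] ->
      is_derive t 1 (fun t => F 0%N 0%N (r', t)) (F 0%N 1%N (r', t)).
    by move=> /inI /(Fd 0%N 0%N _ isT) [].
  have [c cI E] := is_derive_mvt zz D.
  rewrite E -mulrBr !normrM -mulrA.
  apply: ler_pM => //; first by rewrite H2 //; exact: interior_subset (inI c cI).
  apply: (@le_trans _ _ (1 * `|s r' - s r|)).
    by rewrite ler_wpM2r // gtr0_norm // ltW.
  by rewrite mul1r distrC HL // in_itv /= !ltW.
rewrite distrC; apply: (@le_trans _ _ (B1 * `|r - r'| + B2 * L * `|r - r'|)).
  by rewrite -(subrKA (F 0%N 0%N (r', y * s r))) addrC (le_trans (ler_normD _ _)) // lerD.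
by rewrite -mulrDl ler_wpM2r // lerDr.
Qed.

End Range.

(** * Bounded Lipschitz functions of the range variable *)

Section Tame.
Variables (R : realType) (rmax : R).
Implicit Types f g : R -> R[i].

(** One constant serves as bound and as Lipschitz constant, so that sums, products and inverses stay
    in the class. The interval is open because the estimate for [gam] comes from interior
    derivatives; the midpoints of the scheme lie strictly inside. *)
Definition tame (B : R) f := forall r r', 0 < r < rmax -> 0 < r' < rmax ->
  modc (f r) <= B /\ modc (f r - f r') <= B * `|r - r'|.

Lemma tame_le B B' f : B <= B' -> tame B f -> tame B' f.
Proof.
move=> BB' Bf r r' rI r'I; have [H1 H2] := Bf r r' rI r'I.
by rewrite (le_trans H1) // (le_trans H2) // ler_wpM2r.
Qed.

Lemma tame_cst c : tame (modc c) (fun=> c).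
Proof. by move=> r r' _ _; rewrite subrr modc0 mulr_ge0 ?modc_ge0. Qed.

Lemma tameD B B' f g : tame B f -> tame B' g -> tame (B + B') (fun r => f r + g r).
Proof.
move=> Bf Bg r r' rI r'I.
have [f1 f2] := Bf r r' rI r'I; have [g1 g2] := Bg r r' rI r'I.
rewrite (le_trans (modcD _ _)) ?lerD // opprD addrACA mulrDl.
by rewrite (le_trans (modcD _ _)) ?lerD.
Qed.

Lemma tameM B B' f g : 0 <= B -> 0 <= B' -> tame B f -> tame B' g ->
  tame (2 * B * B') (fun r => f r * g r).
Proof.
move=> B0 B'0 Bf Bg r r' rI r'I.
have [f1 f2] := Bf r r' rI r'I; have [g1 g2] := Bg r r' rI r'I.
have [f1' _] := Bf r' r r'I rI.
split.
  rewrite modcM; apply: (@le_trans _ _ (B * B')); first by rewrite ler_pM ?modc_ge0.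
  by have := mulr_ge0 B0 B'0; lra.
have -> : f r * g r - f r' * g r' = (f r - f r') * g r + f r' * (g r - g r') by ring.
apply: le_trans (modcD _ _) _; rewrite !modcM.
apply: (@le_trans _ _ (B * `|r - r'| * B' + B * (B' * `|r - r'|))).
  by rewrite lerD // ler_pM ?modc_ge0.
by rewrite le_eqVlt; apply/orP; left; apply/eqP; ring.
Qed.

(** The constant adds the bound [m^-1] to the Lipschitz constant [B / m ^+ 2]. *)
Lemma tameV B m f : 0 <= B -> 0 < m ->
  (forall r, 0 < r < rmax -> m <= modc (f r)) -> tame B f ->
  tame (m^-1 + B / m ^+ 2) (fun r => (f r)^-1).
Proof.
move=> B0 m0 mf Bf r r' rI r'I.
have inv t : 0 < t < rmax -> modc (f t)^-1 <= m^-1.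
  move=> tI; rewrite modcV lef_pV2 ?posrE ?mf //.
  exact: lt_le_trans m0 (mf t tI).
have nz t : 0 < t < rmax -> f t != 0.
  move=> tI; apply/eqP => ft; have := mf t tI; rewrite ft modc0 leNgt.
  by rewrite m0.
have m2 : 0 <= B / m ^+ 2 by rewrite mulr_ge0 // invr_ge0 exprn_ge0 // ltW.
have [_ f2] := Bf r r' rI r'I.
split; first by rewrite (le_trans (inv r rI)) // lerDl.
have -> : (f r)^-1 - (f r')^-1 = (f r' - f r) * ((f r)^-1 * (f r')^-1).
  by field; rewrite !nz.
rewrite !modcM -modcB.
apply: (@le_trans _ _ (B * `|r - r'| * (m^-1 * m^-1))).
  by rewrite ler_pM ?mulr_ge0 ?modc_ge0 // ler_pM ?modc_ge0 // inv.
rewrite -expr2 exprVn mulrAC ler_wpM2r // lerDr invr_ge0; exact: ltW.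
Qed.

Lemma tame_real B (f : R -> R) :
  (forall r, 0 < r < rmax -> `|f r| <= B) ->
  (forall r r', 0 < r < rmax -> 0 < r' < rmax -> `|f r - f r'| <= B * `|r - r'|) ->
  tame B (fun r => (f r)%:C).
Proof.
move=> f1 f2 r r' rI r'I; rewrite -raddfB !modc_real.
by split; [exact: f1|exact: f2].
Qed.

End Tame.

Section Coefficients.
Variables (R : realType) (rmax alpha : R) (p q : R[i]).
Variables (s : R -> R) (beta : R * R -> R[i]).
Hypotheses (hrmax : 0 < rmax) (halpha : 0 < alpha) (hq : q != 0).
Hypothesis (hs_smooth : smooth1 `[0, rmax] s).
Hypotheses (hs_pos : forall r, 0 <= r <= rmax -> 0 < s r).
Hypotheses (hs_dot : forall r, 0 <= r <= rmax -> 0 < sdot rmax s r).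
Hypothesis (hbeta : smoothC_upto (calD rmax s) beta).

Let itvW r : 0 < r < rmax -> r \in `[0, rmax].
Proof. by rewrite in_itv /= => /andP[r0 r1]; rewrite !ltW. Qed.

Lemma tame_of_lipschitz (f : R -> R) :
  {within `[0, rmax], continuous f} ->
  (exists2 L, 0 <= L & forall r r', r \in `[0, rmax] -> r' \in `[0, rmax] ->
    `|f r - f r'| <= L * `|r - r'|) ->
  exists2 B, 0 <= B & tame rmax B (fun r => (f r)%:C).
Proof.
move=> fc [L L0 HL].
have [B B0 HB] := within_continuous_bounded (@segment_compact _ _ _) fc.
exists (B + L); first by rewrite addr_ge0.
apply: tame_real => [r rI|r r' rI r'I].
  by rewrite (le_trans (HB r _)) ?lerDl //; exact: itvW.
by rewrite (le_trans (HL _ _ (itvW rI) (itvW r'I))) // ler_wpM2r // lerDr.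
Qed.

Lemma tame_s : exists2 B, 0 <= B & tame rmax B (fun r => (s r)%:C).
Proof.
by apply: tame_of_lipschitz; [exact: s_continuous|exact: s_lipschitz].
Qed.

Lemma tame_sdot : exists2 B, 0 <= B & tame rmax B (fun r => (sdot rmax s r)%:C).
Proof.
apply: tame_of_lipschitz; last exact: sdot_lipschitz.
by apply: within_quotient_continuous; exact: sdot_quotient.
Qed.

Lemma s_lower_bound r : 0 < r < rmax -> s 0 <= s r.
Proof. by move=> /andP[r0 r1]; apply: (s_homo hs_smooth hs_dot) => //; exact: ltW. Qed.

Lemma s0_gt0 : 0 < s 0.
Proof. by rewrite hs_pos // lexx ltW. Qed.

Lemma tame_dlt : exists2 B, 0 <= B & tame rmax B (fun r => (dlt rmax s r)%:C).
Proof.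
have [B B0 HB] := tame_s; have [B' B'0 HB'] := tame_sdot.
have s0 := s0_gt0.
have HV : tame rmax ((s 0)^-1 + B / s 0 ^+ 2) (fun r => ((s r)%:C)^-1).
  apply: tameV => // r rI; rewrite modc_real (le_trans (s_lower_bound rI)) //.
  exact: ler_norm.
have V0 : 0 <= (s 0)^-1 + B / s 0 ^+ 2.
  by rewrite addr_ge0 ?divr_ge0 ?invr_ge0 ?exprn_ge0 // ltW.
have := tameM B'0 V0 HB' HV.
set C := 2 * _ * _ => HC; exists C; first by rewrite !mulr_ge0.
by move=> r r' rI r'I; rewrite /dlt !rmorphM !fmorphV; exact: HC.
Qed.

(** The minimum of the continuous positive [sdot] is divided by [s rmax], the largest value of the
    nondecreasing s. *)
Lemma dlt_lower_bound : exists2 m, 0 < m & forall r, 0 < r < rmax -> m <= dlt rmax s r.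
Proof.
have [c cI Hc] := EVT_min (ltW hrmax) (within_quotient_continuous (sdot_quotient hs_smooth)).
have sR : 0 < s rmax by rewrite hs_pos // lexx ltW.
move: (cI); rewrite in_itv /= => cI2.
exists (sdot rmax s c / s rmax); first by rewrite divr_gt0 // hs_dot.
move=> r rI; have rI' := itvW rI; have := rI'; rewrite in_itv /= => rI2.
have [r0 r1] := andP rI2.
apply: ler_pM; rewrite ?invr_ge0 ?(ltW sR) ?Hc //.
  by apply: ltW; exact: hs_dot.
rewrite lef_pV2 ?posrE ?sR ?hs_pos //.
exact: (s_homo hs_smooth hs_dot).
Qed.

Lemma tame_s2 : exists2 B, 0 <= B & tame rmax B (fun r => (s r)%:C ^+ 2).
Proof.
have [B B0 HB] := tame_s; exists (2 * B * B); first by rewrite !mulr_ge0.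
exact: tameM.
Qed.

Lemma tame_xi : exists2 B, 0 <= B & tame rmax B (xi alpha p q s).
Proof.
have [B B0 HB] := tame_s2.
set c := lam alpha p q / (alpha%:C ^+ 2 * q ^+ 2).
exists (2 * modc c * B); first by rewrite !mulr_ge0 ?modc_ge0.
have := tameM (modc_ge0 c) B0 (@tame_cst R rmax c) HB.
have E r : xi alpha p q s r = c * (s r)%:C ^+ 2 by rewrite /xi mulrAC.
by move=> H r r' rI r'I; rewrite !E; exact: H.
Qed.

Lemma tame_gam : exists2 B, 0 <= B &
  forall y, 0 < y < 1 -> tame rmax B (fun r => gam s beta r y).
Proof.
have [bre bim] := hbeta 1%N.
have [B1 B10 H1] := Cm_upto_lipschitz hrmax hs_smooth hs_pos hs_dot bre.
have [B2 B20 H2] := Cm_upto_lipschitz hrmax hs_smooth hs_pos hs_dot bim.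
exists (B1 + B2); first by rewrite addr_ge0.
move=> y yI r r' rI r'I; rewrite /gam.
have [re1 re2] := H1 y r r' yI rI r'I; have [im1 im2] := H2 y r r' yI rI r'I.
split; apply: le_trans (modc_le_ReIm _) _; first exact: lerD.
by rewrite mulrDl !raddfB lerD.
Qed.

Lemma tame_potential : exists2 B, 0 <= B & forall y, 0 < y < 1 ->
  tame rmax B (fun r => potential alpha q s beta r y).
Proof.
have [B B0 HB] := tame_s2; have [B' B'0 HB'] := tame_gam.
set c := (alpha%:C ^+ 2)^-1.
have C0 : 0 <= 2 * modc c * B by rewrite !mulr_ge0 ?modc_ge0.
have C'0 : 0 <= modc q^-1 + B' by rewrite addr_ge0 ?modc_ge0.
exists (2 * (2 * modc c * B) * (modc q^-1 + B')); first exact: mulr_ge0 (mulr_ge0 _ C0) C'0.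
move=> y yI.
have E r : potential alpha q s beta r y = c * (s r)%:C ^+ 2 * (q^-1 + gam s beta r y).
  by rewrite potentialE //; congr (_ * _); rewrite mulrC rmorphM fmorphV !rmorphXn.
have := tameM C0 C'0 (tameM (modc_ge0 c) B0 (@tame_cst R rmax c) HB)
  (tameD (@tame_cst R rmax q^-1) (HB' y yI)).
by move=> H r r' rI r'I; rewrite !E; exact: H.
Qed.

End Coefficients.

(** * Discrete Gronwall inequality *)

Lemma gronwall_step (R : realType) (x x' t g : R) : 0 <= x -> 0 <= t -> t <= 2^-1 -> 0 <= g ->
  x' - x <= t * (x' + x) + g -> x' <= (1 + 4 * t) * x + 2 * g.
Proof.
move=> x0 t0 t2 g0 H; have t1 : 0 < 1 - t by lra.
rewrite -(ler_pM2l t1).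
have : 0 <= t * x * (2^-1 - t) by rewrite !mulr_ge0 // subr_ge0.
have : 0 <= g * (2^-1 - t) by rewrite mulr_ge0 // subr_ge0.
by move: H; lra.
Qed.

(** For t at most 1/2 one has (1+t)/(1-t) <= 1+4t and 1/(1-t) <= 2; this is the origin of the
    factors 4 and 2. *)
Lemma gronwall (R : realType) (x : nat -> R) (k c g : R) (N : nat) :
  0 <= k -> 0 <= c -> 0 <= g -> k * c <= 2^-1 -> (forall n, 0 <= x n) ->
  (forall n, (n < N)%N -> x n.+1 - x n <= k * c * (x n.+1 + x n) + k * g) ->
  forall n, (n <= N)%N ->
  x n <= expR (4 * c * (k * N%:R)) * (x 0%N + 2 * (k * N%:R) * g).
Proof.
move=> k0 c0 g0 kc x0 Hx.
set E := expR (4 * (k * c)).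
have E1 : 1 <= E by rewrite -expR0 ler_expR !mulr_ge0.
have HE : 1 + 4 * (k * c) <= E by exact: expR_ge1Dx.
have step n : (n <= N)%N -> x n <= E ^+ n * (x 0%N + 2 * (k * n%:R) * g).
  elim: n => [_|n IH nN]; first by rewrite expr0 mulr0 mulr0 mul0r addr0 mul1r.
  have := gronwall_step (x0 n) (mulr_ge0 k0 c0) kc (mulr_ge0 k0 g0) (Hx n nN).
  move=> H; apply: le_trans H _.
  (* The new forcing term is enlarged by [E ^+ n.+1 >= 1] so that this power factors out. *)
  apply: (@le_trans _ _ (E * (E ^+ n * (x 0%N + 2 * (k * n%:R) * g)) + E ^+ n.+1 * (2 * (k * g)))).
    rewrite lerD //; first by rewrite ler_pM ?IH ?(ltnW nN) // addr_ge0 ?mulr_ge0.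
    by rewrite ler_peMl ?mulr_ge0 // exprn_ege1.
  by rewrite mulrA -exprS -mulrDr -[n.+1%:R]natr1 le_eqVlt; apply/orP; left; apply/eqP; ring.
move=> n nN; apply: le_trans (step n nN) _.
have -> : expR (4 * c * (k * N%:R)) = E ^+ N.
  by rewrite /E -expRM_natl; congr expR; ring.
apply: ler_pM; rewrite ?exprn_ge0 ?addr_ge0 ?mulr_ge0 ?(le_trans ler01 E1) //.
  by rewrite ler_weXn2l.
by rewrite lerD2l ler_wpM2r // ler_wpM2l // ler_wpM2l // ler_nat.
Qed.

(** * Discrete stability of the scheme *)

Section StabilityConstants.
Variables (R : realType) (K L1 L2 M Rm : R).
Hypotheses (K0 : 0 <= K) (L10 : 0 <= L1) (L20 : 0 <= L2) (M0 : 0 <= M) (Rm0 : 0 <= Rm).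

(** The outcome of [gronwall] with rate [K / 2], zero initial value and total length [Rm]. Defined
    apart from the scheme, so that independence of k and of the mesh is visible. *)
Definition stab_cst : R := expR (2 * K * Rm) * (2 * Rm).

Lemma stab_cst_ge0 : 0 <= stab_cst.
Proof. by rewrite mulr_ge0 ?expR_ge0 // mulr_ge0. Qed.

(** The factors of [H1] and of [k^-1 * H2], in this order, once the Gronwall bound for the quotients
    is inserted into the bound on [W]. *)
Definition stab_cst_transport : R * R :=
  let E := expR (4 * (K / 2 + L1 * M) * Rm) in
  (M * (E * (2 + 2 * Rm * (L1 * M * (1 + stab_cst) + L2 * stab_cst)) + 1 + stab_cst),
   M * (E * (2 * Rm))).

Lemma stab_cst_transport_ge0 : 0 <= stab_cst_transport.1 /\ 0 <= stab_cst_transport.2.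
Proof.
rewrite /stab_cst_transport /=; have := stab_cst_ge0; set c := stab_cst => c0.
set E := expR _; have E0 : 0 <= E by exact: expR_ge0.
by split; repeat (done || apply: addr_ge0 || apply: mulr_ge0).
Qed.

End StabilityConstants.

Section AbstractScheme.
Variables (R : realType) (m : nat).
Local Notation X := 'rV[R[i]]_(m.+1.-1).
Implicit Types v w : X.

Lemma avgE v w : avg v w = (2^-1)%:C *: (v + w).
Proof. by rewrite /avg fmorphV rmorph_nat. Qed.

(** The left-hand inner product is the difference of the squared norms; dividing by the sum of the
    norms makes the estimate linear. If that sum is zero, both norms vanish. *)
Lemma energy_step v w (c g : R) : 0 <= c -> 0 <= g ->
  dot (v - w) (v + w) <= c * norm0h (v + w) ^+ 2 + g * norm0h (v + w) ->
  norm0h v - norm0h w <= c * (norm0h v + norm0h w) + g.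
Proof.
move=> c0 g0; rewrite dotDl !dotDr !dotNl -!norm0h_sqr (dotC w v).
have S0 := norm0h_ge0 (v + w); have SAB := norm0hD v w.
have A0 := norm0h_ge0 v; have B0 := norm0h_ge0 w.
move: (norm0h (v + w)) (norm0h v) (norm0h w) (dot v w) S0 SAB A0 B0.
move=> S A B D S0 SAB A0 B0 H.
have [AB0|AB] := eqVneq (A + B) 0.
  have -> : A = 0 by lra.
  by have -> : B = 0; lra.
have ABpos : 0 < A + B by rewrite lt0r AB addr_ge0.
rewrite -(ler_pM2r ABpos).
have : c * S ^+ 2 <= c * (A + B) ^+ 2 by rewrite ler_wpM2l // ler_pXn2r ?nnegrE // addr_ge0.
have : g * S <= g * (A + B) by rewrite ler_wpM2l.
by move: H; lra.
Qed.

Variables (A : nat -> X -> X) (W : X -> X) (e eta : nat -> X).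
Variables (k K L1 L2 M H1 H2 Rm : R) (N : nat).
Hypotheses (k0 : 0 < k) (K0 : 0 <= K) (L10 : 0 <= L1) (L20 : 0 <= L2) (M0 : 0 <= M).
Hypotheses (H10 : 0 <= H1) (H20 : 0 <= H2).
Hypothesis AB : forall n v w, A n (v - w) = A n v - A n w.
Hypothesis AZ : forall n a v, A n (a%:C *: v) = a%:C *: A n v.
Hypothesis A_diss : forall n v, (n < N)%N -> dot (A n v) v <= K * norm0h v ^+ 2.
Hypothesis A_lip : forall n v, (n.+1 < N)%N ->
  norm0h (A n.+1 v - A n v) <= k * (L1 * norm0h (W v) + L2 * norm0h v).
Hypothesis W_le : forall n v, (n < N)%N -> norm0h (W v) <= M * (norm0h (A n v) + norm0h v).
Hypothesis e0 : e 0%N = 0.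
Hypothesis e_step : forall n, (n < N)%N ->
  k^-1%:C *: (e n.+1 - e n) = A n (avg (e n.+1) (e n)) + eta n.
Hypothesis eta_le : forall n, (n < N)%N -> norm0h (eta n) <= H1.
Hypothesis deta_le : forall n, (n.+1 < N)%N -> norm0h (eta n.+1 - eta n) <= H2.
Hypothesis k_small : k * (K + 2 * (L1 * M)) <= 1.

Hypothesis kN : k * N%:R = Rm.

Let Rm0 : 0 <= Rm. Proof. by rewrite -kN mulr_ge0 // ltW. Qed.

Local Notation stab_cst := (stab_cst K Rm).
Local Notation stab_cst_transport := (stab_cst_transport K L1 L2 M Rm).

Let kK : k * (K / 2) <= 2^-1.
Proof.
have : 0 <= k * (L1 * M) by rewrite !mulr_ge0 // ltW.
by move: k_small; lra.
Qed.

(** The test vector is the sum [e n.+1 + e n] while [A n] acts on half of it, hence [K / 2]. *)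
Lemma error_increment n : (n < N)%N ->
  norm0h (e n.+1) - norm0h (e n) <=
  k * (K / 2) * (norm0h (e n.+1) + norm0h (e n)) + k * H1.
Proof.
move=> nN; have k0' := ltW k0; have h2 : 0 <= K / 2 by rewrite divr_ge0.
apply: energy_step; first exact: mulr_ge0; first exact: mulr_ge0.
have -> : e n.+1 - e n = k%:C *: (k^-1%:C *: (e n.+1 - e n)).
  by rewrite scalerA -rmorphM mulfV ?gt_eqF // rmorph1 scale1r.
rewrite e_step // dotZl dotDl avgE AZ dotZl -[X in _ <= X + _]mulrA -[X in _ <= _ + X]mulrA.
rewrite -mulrDr ler_wpM2l // lerD //.
  by rewrite mulrAC mulrC ler_wpM2r ?invr_ge0 // A_diss.
apply: le_trans (dot_le_norm _ _) _; rewrite ler_wpM2r ?norm0h_ge0 //; exact: eta_le.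
Qed.

Lemma error_le n : (n <= N)%N -> norm0h (e n) <= stab_cst * H1.
Proof.
move=> nN; have := gronwall (x := fun n => norm0h (e n)) (ltW k0) _ H10 kK
  (fun n => norm0h_ge0 _) error_increment nN.
rewrite e0 norm0h0 add0r kN => /(_ (divr_ge0 K0 (ler0n _ _))) H.
apply: le_trans H _; rewrite /stab_cst mulrA le_eqVlt; apply/orP; left; apply/eqP.
by congr (expR _ * _ * _); field.
Qed.

Lemma avg_error_le n : (n < N)%N -> norm0h (avg (e n.+1) (e n)) <= stab_cst * H1.
Proof.
move=> nN; rewrite avgE norm0hZ modc_real gtr0_norm ?invr_gt0 //.
have := norm0hD (e n.+1) (e n).
have := error_le nN; have := error_le (ltnW nN); lra.
Qed.

Let d n := k^-1%:C *: (e n.+1 - e n).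

(** A single Gronwall step from [e 0 = 0] yields a bound on [e 1] with a factor k, which the
    quotient cancels; the global bound [stab_cst * H1] would leave [k^-1] here. *)
Let d0_le : (0 < N)%N -> norm0h (d 0%N) <= 2 * H1.
Proof.
move=> N0; rewrite /d e0 subr0 norm0hZ modc_real gtr0_norm ?invr_gt0 //.
have := gronwall_step (norm0h_ge0 _) _ kK (mulr_ge0 (ltW k0) H10) (error_increment N0).
rewrite e0 norm0h0 mulr0 add0r ler_pdivrMl // => H.
by rewrite mulrCA; apply: H; rewrite !mulr_ge0 // ltW.
Qed.

Let W_avg_le n : (n < N)%N ->
  norm0h (W (avg (e n.+1) (e n))) <= M * (norm0h (d n) + H1 + stab_cst * H1).
Proof.
move=> nN; apply: le_trans (W_le _ nN) _; rewrite ler_wpM2l // lerD ?avg_error_le //.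
have -> : A n (avg (e n.+1) (e n)) = d n - eta n by rewrite /d e_step // addrK.
by apply: le_trans (norm0hB _ _) _; rewrite lerD2l eta_le.
Qed.

(** The forcing in the recursion for [d], per unit of k. The increment of eta brings no factor k of
    its own, hence [k^-1 * H2]. *)
Let g2 := L1 * M * (H1 + stab_cst * H1) + L2 * (stab_cst * H1) + k^-1 * H2.

Let g20 : 0 <= g2.
Proof. by rewrite !addr_ge0 ?mulr_ge0 ?addr_ge0 ?mulr_ge0 ?invr_ge0 ?stab_cst_ge0 // ltW. Qed.

(* Subtracting two consecutive error equations gives a scheme of the same form for [d]; the
   variation of [A] costs [W], which the error equation itself bounds in terms of [d]. *)
Let d_increment n : (n.+1 < N)%N ->
  norm0h (d n.+1) - norm0h (d n) <=
  k * (K / 2 + L1 * M) * (norm0h (d n.+1) + norm0h (d n)) + k * g2.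
Proof.
move=> nN; have nN' := ltnW nN.
set a := avg (e n.+1) (e n).
set G := (A n.+1 a - A n a) + (eta n.+1 - eta n).
have dE : d n.+1 - d n = (k / 2)%:C *: A n.+1 (d n.+1 + d n) + G.
  have -> : (k / 2)%:C *: A n.+1 (d n.+1 + d n) =
      A n.+1 (avg (e n.+2) (e n.+1)) - A n.+1 a.
    rewrite -AB -AZ; congr (A _ _); rewrite /a !avgE /d -scalerDr scalerA -rmorphM.
    have -> : k / 2 * k^-1 = 2^-1 by field; rewrite gt_eqF.
    by rewrite -scalerBr; congr (_ *: _); apply/rowP => i; rewrite !mxE; ring.
  rewrite /d !e_step // -/a /G; move: (A n.+1 _) (A n.+1 a) (A n a) => x y z.
  by apply/rowP => i; rewrite !mxE; ring.
have G_le : norm0h G <= k * (L1 * M) * norm0h (d n) + k * g2.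
  apply: le_trans (norm0hD _ _) _.
  have := deta_le nN; have := A_lip a nN.
  have := ler_wpM2l L10 (W_avg_le nN'); have := ler_wpM2l L20 (avg_error_le nN').
  rewrite -/a => h1 h2 h3 h4.
  apply: le_trans (lerD h3 h4) _.
  have -> : k * g2 = k * (L1 * M * (H1 + stab_cst * H1) + L2 * (stab_cst * H1)) + H2.
    by rewrite /g2; field; rewrite gt_eqF.
  rewrite addrA lerD2r; apply: le_trans (ler_wpM2l (ltW k0) (lerD h2 h1)) _.
  by rewrite le_eqVlt; apply/orP; left; apply/eqP; ring.
have E : norm0h (d n.+1) - norm0h (d n) <=
    k * (K / 2) * (norm0h (d n.+1) + norm0h (d n)) + norm0h G.
  apply: energy_step; [by rewrite mulr_ge0 ?divr_ge0 // ltW|exact: norm0h_ge0|].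
  rewrite dE dotDl dotZl lerD ?dot_le_norm //.
  have -> : k * (K / 2) * norm0h (d n.+1 + d n) ^+ 2 =
    k / 2 * (K * norm0h (d n.+1 + d n) ^+ 2) by field.
  by rewrite ler_wpM2l ?A_diss // mulr_ge0 ?invr_ge0 // ltW.
have u0 : 0 <= k * (L1 * M) * norm0h (d n.+1).
  by rewrite !mulr_ge0 ?norm0h_ge0 // ltW.
apply: le_trans E _; rewrite [k * (K / 2 + _)]mulrDr mulrDl -addrA lerD2l.
apply: le_trans G_le _; rewrite lerD2r mulrDr lerDr; exact: u0.
Qed.

Let d_le n : (n < N)%N ->
  norm0h (d n) <= expR (4 * (K / 2 + L1 * M) * Rm) * (2 * H1 + 2 * Rm * g2).
Proof.
move=> nN; have N0 : (0 < N)%N by exact: leq_ltn_trans nN.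
have c0 : 0 <= K / 2 + L1 * M by rewrite addr_ge0 ?mulr_ge0.
have kc : k * (K / 2 + L1 * M) <= 2^-1 by move: k_small; lra.
(* [d] has indices 0 to N-1, so its recursion has N-1 steps; the total length is then only bounded
   by [Rm]. *)
have step n' : (n' < N.-1)%N -> norm0h (d n'.+1) - norm0h (d n') <=
    k * (K / 2 + L1 * M) * (norm0h (d n'.+1) + norm0h (d n')) + k * g2.
  by move=> H; apply: d_increment; rewrite -(prednK N0) ltnS.
have nN1 : (n <= N.-1)%N by rewrite -ltnS prednK.
have := gronwall (x := fun n => norm0h (d n)) (ltW k0) c0 g20 kc
  (fun n => norm0h_ge0 _) step nN1.
move=> H; apply: le_trans H _.
have RR : k * N.-1%:R <= Rm by rewrite -kN ler_wpM2l ?(ltW k0) // ler_nat leq_pred.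
have R0 : 0 <= k * N.-1%:R by rewrite mulr_ge0 // ltW.
apply: ler_pM; rewrite ?expR_ge0 ?addr_ge0 ?norm0h_ge0 ?mulr_ge0 ?(ltW k0) //.
  by rewrite ler_expR ler_wpM2l // mulr_ge0.
by rewrite lerD ?d0_le // ler_wpM2r // ler_wpM2l.
Qed.

Lemma transport_error_le n : (n < N)%N ->
  norm0h (W (avg (e n.+1) (e n))) <=
  stab_cst_transport.1 * H1 + stab_cst_transport.2 * (k^-1 * H2).
Proof.
move=> nN; apply: le_trans (W_avg_le nN) _.
have := d_le nN; rewrite /stab_cst_transport /g2 /=.
set E := expR _; set c := stab_cst => h.
apply: (@le_trans _ _ (M * (E * (2 * H1 + 2 * Rm *
      (L1 * M * (H1 + c * H1) + L2 * (c * H1) + k^-1 * H2)) + H1 + c * H1))).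
  by rewrite ler_wpM2l // !lerD2r.
by rewrite le_eqVlt; apply/orP; left; apply/eqP; ring.
Qed.

End AbstractScheme.

(** * The operator of one range step *)

Section StepOperator.
Variables (R : realType) (rmax alpha : R) (p q : R[i]).
Variables (s : R -> R) (beta : R * R -> R[i]) (n : nat).
Local Notation J := n.+1.
Local Notation X := 'rV[R[i]]_(J.-1).
Local Notation T r := (@Th R J alpha q s beta r).
Implicit Types v w : X.

Definition step_op (r : R) v : X :=
  (dlt rmax s r)%:C *: transport v + ('i * xi alpha p q s r) *: T r v
  + ('i * (lam alpha p q / q)) *: v.

Lemma step_op_is_linear r : linear (step_op r).
Proof.
move=> c v w; rewrite /step_op transportD transportZ /Th mulmxDl -scalemxAl.
by apply/rowP => i; rewrite !mxE; ring.
Qed.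

HB.instance Definition _ r :=
  GRing.isLinear.Build R[i] X X *:%R (step_op r) (step_op_is_linear r).

Lemma scheme_lhs_rhs N (V : nat -> X) i :
  scheme_lhs rmax s N V i - scheme_rhs rmax alpha p q s beta N V i =
  (kstep rmax N)^-1%:C *: (V i - V i.-1)
  - step_op (rmid rmax N i) (avg (V i) (V i.-1)).
Proof.
by rewrite /scheme_lhs /scheme_rhs /step_op /transport fmorphV -addrA -opprD !addrA.
Qed.

Lemma scheme_step N (V : nat -> X) i g :
  scheme_lhs rmax s N V i = scheme_rhs rmax alpha p q s beta N V i + g ->
  (kstep rmax N)^-1%:C *: (V i - V i.-1)
  = step_op (rmid rmax N i) (avg (V i) (V i.-1)) + g.
Proof.
move=> E; have := scheme_lhs_rhs N V i; rewrite E addrAC subrr add0r => ->.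
by rewrite [RHS]addrC subrK.
Qed.

Lemma scheme_step0 N (V : nat -> X) i :
  scheme_lhs rmax s N V i = scheme_rhs rmax alpha p q s beta N V i ->
  (kstep rmax N)^-1%:C *: (V i - V i.-1)
  = step_op (rmid rmax N i) (avg (V i) (V i.-1)).
Proof.
move=> E; have := scheme_lhs_rhs N V i; rewrite E subrr => /esym/eqP.
by rewrite subr_eq0 => /eqP.
Qed.

Variables (C B m : R).
Hypotheses (C0 : 0 <= C) (B0 : 0 <= B) (m0 : 0 < m) (n2 : (2 <= n)%N).
Hypothesis HT : stable_resolvent rmax alpha q s beta C.
Hypothesis tdlt : tame rmax B (fun r => (dlt rmax s r)%:C).
Hypothesis dlt_ge : forall r, 0 < r < rmax -> m <= dlt rmax s r.
Hypothesis txi : tame rmax B (xi alpha p q s).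
Hypothesis tpot : forall y, 0 < y < 1 -> tame rmax B (fun r => potential alpha q s beta r y).

Let P := B * C + modc (lam alpha p q / q).

Let P0 : 0 <= P.
Proof. by rewrite addr_ge0 ?mulr_ge0 ?modc_ge0. Qed.

Let itvW r : 0 < r < rmax -> 0 <= r <= rmax.
Proof. by move=> /andP[r0 r1]; rewrite !ltW. Qed.

Let T_le r v : 0 < r < rmax -> norm0h (T r v) <= C * norm0h v.
Proof. by move=> rI; apply: (Th_bounded _ HT) => //; exact: itvW. Qed.

Let lower_order_le r v : 0 < r < rmax ->
  norm0h (('i * xi alpha p q s r) *: T r v + ('i * (lam alpha p q / q)) *: v)
  <= P * norm0h v.
Proof.
move=> rI; apply: le_trans (norm0hD _ _) _.
rewrite !norm0hZ !(modcM 'i) !modci !mul1r /P mulrDl lerD // -mulrA.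
by apply: ler_pM; rewrite ?modc_ge0 ?norm0h_ge0 ?T_le //; have [] := txi rI rI.
Qed.

(** [dot_transport] is one-sided, so it may be multiplied by [dlt] only because [dlt] is
    nonnegative; the remaining terms are bounded in norm. *)
Lemma step_op_dissipative r v : 0 < r < rmax ->
  dot (step_op r v) v <= (B + P) * norm0h v ^+ 2.
Proof.
move=> rI; rewrite /step_op -addrA dotDl dotZl mulrDl lerD //; last first.
  apply: le_trans (dot_le_norm _ _) _.
  by rewrite expr2 mulrA ler_wpM2r ?norm0h_ge0 // lower_order_le.
have d0 : 0 <= dlt rmax s r by apply: le_trans (ltW m0) (dlt_ge rI).
apply: le_trans (ler_wpM2l d0 (dot_transport v)) _.
have [+ _] := tdlt rI rI; rewrite modc_real ger0_norm // => dB.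
rewrite mulrA ler_wpM2r ?sqr_ge0 //; lra.
Qed.

(** [B * C] comes from the variation of [xi] with the resolvent bounded by C; [B ^+ 2 * C ^+ 2] is
    the bound on [xi] times the Lipschitz constant of the resolvent. *)
Lemma step_op_lipschitz r r' v : 0 < r < rmax -> 0 < r' < rmax ->
  norm0h (step_op r v - step_op r' v) <=
  `|r - r'| * (B * norm0h (transport v) + (B * C + B ^+ 2 * C ^+ 2) * norm0h v).
Proof.
move=> rI r'I.
have -> : step_op r v - step_op r' v =
   ((dlt rmax s r)%:C - (dlt rmax s r')%:C) *: transport v +
   ('i * (xi alpha p q s r - xi alpha p q s r') *: T r v +
    'i * xi alpha p q s r' *: (T r v - T r' v)).
  by apply/rowP => i; rewrite !mxE; ring.
have [_ d2] := tdlt rI r'I; have [_ x2] := txi rI r'I; have [x1 _] := txi r'I r'I.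
apply: le_trans (norm0hD _ _) _; rewrite [X in _ <= X]mulrDr lerD //.
  by rewrite norm0hZ mulrA (mulrC `|_|) ler_wpM2r ?norm0h_ge0.
apply: le_trans (norm0hD _ _) _; rewrite [X in _ <= _ * X]mulrDl [X in _ <= X]mulrDr lerD //.
  rewrite norm0hZ modcM modci mul1r.
  have -> : `|r - r'| * (B * C * norm0h v) = B * `|r - r'| * (C * norm0h v) by ring.
  by rewrite ler_pM ?modc_ge0 ?norm0h_ge0 ?T_le.
rewrite norm0hZ modcM modci mul1r.
have TL := Th_lipschitz v C0 (mulr_ge0 B0 (normr_ge0 (r - r'))) HT n2 (itvW rI) (itvW r'I)
  (fun y yI => (tpot yI rI r'I).2).
have -> : `|r - r'| * (B ^+ 2 * C ^+ 2 * norm0h v) =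
  B * (C ^+ 2 * (B * `|r - r'|) * norm0h v) by ring.
by rewrite ler_pM ?modc_ge0 ?norm0h_ge0.
Qed.

Lemma transport_le_step_op r v : 0 < r < rmax ->
  norm0h (transport v) <= m^-1 * (1 + P) * (norm0h (step_op r v) + norm0h v).
Proof.
move=> rI; rewrite -mulrA ler_pdivlMl //.
have d0 : 0 <= dlt rmax s r by apply: le_trans (ltW m0) (dlt_ge rI).
apply: (@le_trans _ _ (norm0h ((dlt rmax s r)%:C *: transport v))).
  by rewrite norm0hZ modc_real ger0_norm // ler_wpM2r ?norm0h_ge0 ?dlt_ge.
have -> : (dlt rmax s r)%:C *: transport v = step_op r v -
    (('i * xi alpha p q s r) *: T r v + ('i * (lam alpha p q / q)) *: v).
  by rewrite /step_op -(addrA (_ *: transport v)) addrK.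
apply: le_trans (norm0hB _ _) _; have := lower_order_le v rI.
have := norm0h_ge0 (step_op r v); have := norm0h_ge0 v.
move: (norm0h (step_op r v)) (norm0h v) (norm0h _) => a b c b0 a0 h.
have : 0 <= P * a by rewrite mulr_ge0.
by move: h; lra.
Qed.

End StepOperator.

Lemma bigmax_nat_ge (R : realType) (F : nat -> R) a b i :
  (a <= i < b)%N -> F i <= \big[Num.max/0]_(a <= j < b) F j.
Proof. by move=> iab; apply: le_bigmax_seq => //; rewrite mem_index_iota. Qed.

(** [0 <= x] accounts for the default value 0 of an empty maximum, which occurs for N = 1 when the
    index starts at 2. *)
Lemma bigmax_nat_le (R : realType) (F : nat -> R) a b x : 0 <= x ->
  (forall i, (a <= i < b)%N -> F i <= x) -> \big[Num.max/0]_(a <= j < b) F j <= x.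
Proof.
move=> x0 Fx; rewrite big_nat; elim/big_ind : _ => // y z yx zx.
by rewrite ge_max yx zx.
Qed.

Lemma bigmax_nat_ge0 (R : realType) (F : nat -> R) a b :
  0 <= \big[Num.max/0]_(a <= j < b) F j.
Proof. exact: bigmax_ge_id. Qed.

Theorem theorem4p2 (R : realType) (rmax alpha : R) (p q : R[i])
    (s : R -> R) (beta : R * R -> R[i]) (u0 : R -> R[i]) (u : R * R -> R[i])
    (hrmax : 0 < rmax) (halpha : 0 < alpha) (hq : q != 0)
    (hs_smooth : smooth1 `[0, rmax] s)
    (hs_pos : forall r, 0 <= r <= rmax -> 0 < s r)
    (hs_dot : forall r, 0 <= r <= rmax -> 0 < sdot rmax s r)
    (hbeta : smoothC_upto (calD rmax s) beta)
    (hu : is_solution rmax alpha p q s beta u0 u)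
    (hcond :
      0 < inf [set 1 / CDPF R ^+ 2
                   - s x.1 ^+ 2 / (alpha ^+ 2 * modc q ^+ 2)
                     * (complex.Re q
                        + modc q ^+ 2 * complex.Re (gam s beta x.1 x.2))
              | x in Omega rmax]
      \/
      exists dstar : R, (dstar = 1 \/ dstar = -1) /\
        0 < inf [set dstar * s x.1 ^+ 2 / (alpha ^+ 2 * modc q ^+ 2)
                     * (complex.Im q
                        - modc q ^+ 2 * complex.Im (gam s beta x.1 x.2))
                | x in Omega rmax]) :
  exists C1 C2 C3 : R, [/\ 0 < C1, 0 < C2, 0 <= C3 &
    forall (J N : nat) (U eta : nat -> 'rV[R[i]]_(J.-1)),
      (3 <= J)%N -> (1 <= N)%N ->
      is_scheme_solution rmax alpha p q s beta N u0 U ->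
      (forall n, (1 <= n <= N)%N ->
         scheme_lhs rmax s N (nodal rmax J N u) n
         = scheme_rhs rmax alpha p q s beta N (nodal rmax J N u) n + eta n) ->
      C3 * kstep rmax N <= 3 ->
      \big[Num.max/0]_(0 <= n < N.+1) norm0h (U n - nodal rmax J N u n)
        <= C1 * \big[Num.max/0]_(1 <= n < N.+1) norm0h (eta n)
      /\
      \big[Num.max/0]_(2 <= n < N.+1)
          norminfh (otimes (omega J)
            (avg (nodal rmax J N u n) (nodal rmax J N u n.-1)
             - avg (U n) (U n.-1)))
        <= C2 * ((kstep rmax N)^-1
                   * \big[Num.max/0]_(2 <= n < N.+1) norm0h (eta n - eta n.-1)
                 + \big[Num.max/0]_(1 <= n < N.+1) norm0h (eta n))].
Proof.
have [C C0 HT] := Th_stable halpha hq hcond.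
have [B1 B10 t1] := tame_dlt hrmax hs_smooth hs_pos hs_dot.
have [B2 B20 t2] := tame_xi alpha p q hs_smooth.
have [B3 B30 t3] := tame_potential hrmax halpha hq hs_smooth hs_pos hs_dot hbeta.
have [m m0 dm] := dlt_lower_bound hrmax hs_smooth hs_pos hs_dot.

set B := B1 + (B2 + B3); have B0 : 0 <= B by rewrite !addr_ge0.
have le1 : B1 <= B by rewrite lerDl addr_ge0.
have le2 : B2 <= B by rewrite /B addrCA lerDl addr_ge0.
have le3 : B3 <= B by rewrite /B addrA lerDr addr_ge0.
have {}t1 := tame_le le1 t1; have {}t2 := tame_le le2 t2.
have {}t3 y (yI : 0 < y < 1) := tame_le le3 (t3 y yI).
set P := B * C + modc (lam alpha p q / q).
have P0 : 0 <= P by rewrite addr_ge0 ?mulr_ge0 ?modc_ge0.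
pose K := B + P; pose L1 := B; pose L2 := B * C + B ^+ 2 * C ^+ 2.
pose M := m^-1 * (1 + P).
have K0 : 0 <= K by rewrite addr_ge0.
have L20 : 0 <= L2 by rewrite addr_ge0 ?mulr_ge0 ?exprn_ge0.
have M0 : 0 <= M by apply: mulr_ge0; [rewrite invr_ge0; exact: ltW|exact: addr_ge0].
pose c1 := stab_cst K rmax; pose c2 := stab_cst_transport K L1 L2 M rmax.
have c10 : 0 <= c1 by apply: stab_cst_ge0; exact: ltW.
have [c20 c20'] : 0 <= c2.1 /\ 0 <= c2.2.
  by apply: stab_cst_transport_ge0 => //; exact: ltW.
(* The factors 2 are those of [norminfh_omega_le]; the added 1 only makes the constant strictly
   positive. *)
pose D := 2 * (c2.1 + c2.2) + 2 * c1 + 1.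
have D0 : 0 < D.
  by apply: ltr_wpDl => //; apply: addr_ge0; apply: mulr_ge0 => //; exact: addr_ge0.
(* With this third constant, C3 k <= 3 is exactly the smallness condition of the abstract scheme. *)
exists (c1 + 1), D, (3 * (K + 2 * (L1 * M))).
split => //; first by rewrite ltr_wpDl.
  by apply: mulr_ge0 => //; apply: addr_ge0 => //; do 2 apply: mulr_ge0 => //.
move=> [//|J] N U eta J3 N1 [U0 Usch] usch k3.

set k := kstep rmax N in k3 *.
have k0 : 0 < k by rewrite /k /kstep divr_gt0 // ltr0n.
have kN : k * N%:R = rmax by rewrite /k /kstep divfK // pnatr_eq0 -lt0n.
have k_small : k * (K + 2 * (L1 * M)) <= 1.
  by move: k3; rewrite -mulrA [X in _ * X]mulrC; lra.
have mid n : (n < N)%N -> 0 < rmid rmax N n.+1 < rmax.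
  move=> nN; rewrite /rmid /rnode /= -/k.
  have n0 : 0 <= n%:R * k by rewrite mulr_ge0 // ltW.
  have n1 : n.+1%:R * k <= rmax by rewrite -kN mulrC ler_pM2l // ler_nat.
  move: n1 n0; rewrite -natr1 mulrDl mul1r; move: (n%:R * k) => x.
  by clear -k0 => xr x0; apply/andP; split; lra.
have dmid n : `|rmid rmax N n.+2 - rmid rmax N n.+1| = k.
  rewrite /rmid /rnode /= -/k -[n.+2%:R]natr1 -[n.+1%:R]natr1.
  by rewrite -[RHS]gtr0_norm //; congr (`|_|); field.
pose e n := nodal rmax J.+1 N u n - U n.
(* Indices are shifted by one: [A n] and [eta n.+1] belong to the step from n to n+1. *)
pose A n := @step_op R rmax alpha p q s beta J (rmid rmax N n.+1).
set H1 := \big[Num.max/0]_(1 <= n < N.+1) norm0h (eta n).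
set H2 := \big[Num.max/0]_(2 <= n < N.+1) norm0h (eta n - eta n.-1).
have H10 : 0 <= H1 by exact: bigmax_nat_ge0.
have H20 : 0 <= H2 by exact: bigmax_nat_ge0.
have AB n v w : A n (v - w) = A n v - A n w by rewrite /A linearB.
have AZ n a v : A n (a%:C *: v) = a%:C *: A n v by rewrite /A linearZ.
have A_diss n v : (n < N)%N -> dot (A n v) v <= K * norm0h v ^+ 2.
  by move=> /mid nI; exact: (step_op_dissipative m0 J3 HT t1 dm t2).
have A_lip n v : (n.+1 < N)%N ->
    norm0h (A n.+1 v - A n v) <= k * (L1 * norm0h (transport v) + L2 * norm0h v).
  move=> nN; rewrite -(dmid n).
  by apply: (step_op_lipschitz C0 B0 J3 HT t1 t2 t3); apply: mid => //; exact: ltnW.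
have W_le n v : (n < N)%N -> norm0h (transport v) <= M * (norm0h (A n v) + norm0h v).
  by move=> /mid nI; exact: (transport_le_step_op C0 B0 m0 J3 HT dm t2).
have e0 : e 0%N = 0.
  case: hu => _ _ _ _ hu0; rewrite /e U0; apply/rowP => i; rewrite !mxE /rnode mul0r.
  have /andP[y0 y1] := node_itv R i.
  by rewrite hu0 ?subrr // !ltW.
have avgB n : avg (e n.+1) (e n) =
    avg (nodal rmax J.+1 N u n.+1) (nodal rmax J.+1 N u n) - avg (U n.+1) (U n).
  by rewrite /e; apply/rowP => i; rewrite !mxE; ring.
have e_step n : (n < N)%N ->
    k^-1%:C *: (e n.+1 - e n) = A n (avg (e n.+1) (e n)) + eta n.+1.
  move=> nN.
  have uE := scheme_step (usch n.+1 nN).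
  have UE := scheme_step0 (Usch n.+1 nN).
  have -> : e n.+1 - e n = (nodal rmax J.+1 N u n.+1 - nodal rmax J.+1 N u n) -
      (U n.+1 - U n) by rewrite /e; apply/rowP => i; rewrite !mxE; ring.
  rewrite /= -/k in UE uE; rewrite avgB AB scalerBr UE uE addrAC.
  by [].
have eta_le n : (n < N)%N -> norm0h (eta n.+1) <= H1.
  by move=> nN; exact: (bigmax_nat_ge (fun n => norm0h (eta n))).
have deta_le n : (n.+1 < N)%N -> norm0h (eta n.+2 - eta n.+1) <= H2.
  by move=> nN; exact: (bigmax_nat_ge (fun n => norm0h (eta n - eta n.-1))).
have L10 : 0 <= L1 by [].
split.
  apply: bigmax_nat_le => [|n nN]; first by rewrite mulr_ge0 ?addr_ge0.
  rewrite -norm0hN opprB.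
  have := error_le k0 K0 L10 M0 H10 AZ A_diss e0 e_step eta_le k_small kN nN.
  rewrite -/(e n) -/c1 mulrDl mul1r => H; apply: le_trans H _.
  by rewrite lerDl.
apply: bigmax_nat_le => [|[|n] // nN].
  apply: mulr_ge0; first exact: ltW.
  by apply: addr_ge0 => //; apply: mulr_ge0 => //; rewrite invr_ge0 ltW.
rewrite /= -avgB; apply: le_trans (norminfh_omega_le _) _.
have {}nN : (n < N)%N by case/andP: nN.
have h1 := transport_error_le k0 K0 L10 L20 M0 H10 H20 AB AZ A_diss A_lip W_le e0
   e_step eta_le deta_le k_small kN.
have h2 := avg_error_le k0 K0 L10 M0 H10 AZ A_diss e0 e_step eta_le k_small kN.
apply: le_trans (lerD (ler_wpM2l _ (h1 n nN)) (ler_wpM2l _ (h2 n nN))) _ => //.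
rewrite -/c1 -/c2 /D; have : 0 <= k^-1 * H2 by rewrite mulr_ge0 // invr_ge0 ltW.
move: (k^-1 * H2) c20 c20' => x; clear -c10 H10.
move: c2.1 c2.2 => y z y0 z0 x0.
have := mulr_ge0 y0 x0; have := mulr_ge0 z0 H10; have := mulr_ge0 c10 x0; lra.
Qed.
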